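(* Let $F_1,\dots,F_k$ be the equivalence classes of $\Delta_1$ for the relation $\equiv$, and let $G_R=\mathrm{Aut}^0_gA_C/R_u$, where $R_u$ is the unipotent radical of $\mathrm{Aut}^0_gA_C$. Then $Gl_{F_1}\times\dots\times Gl_{F_k}\simeq G_R$.
   Context: The base field $k$ is algebraically closed of characteristic $0$ (the letter $k$ is also used for the number of equivalence classes). $M$ is a free $\mathbb Z$-module of finite rank, $M^*=\mathrm{Hom}_{\mathbb Z}(M,\mathbb Z)$, $T_M=\mathrm{Spec}\,k[M]$. $X$ is a complete toric variety over $k$ with torus $T_M$, given by a fan $\Delta$ in $M^*\otimes\mathbb Q$. The rays of $\Delta$ are identified with their primitive generators (epimorphisms) $v_i:M\to\mathbb Z$; $\Delta_1=\{v_1,\dots,v_r\}$ is the set of rays and $H_1,\dots,H_r$ are the corresponding $T_M$-invariant irreducible hypersurfaces. $N$ is the Weil divisor class group of $X$, with exact sequence $0\to M\xrightarrow{v}\mathbb Z^r\xrightarrow{\pi}N\to0$, $v(\alpha)=(v_1(\alpha),\dots,v_r(\alpha))$, $\pi(n_1,\dots,n_r)=[\sum n_iH_i]$. $A_C=k[y_1,\dots,y_r]$ is graded by $N$ via $\deg y^n=\pi(n)$. $\mathrm{Aut}_gA_C$ is the affine algebraic group of $N$-graded $k$-algebra automorphisms of $A_C$ and $\mathrm{Aut}_g^0A_C$ its identity component. Roots: $v_i$ also denotes the $i$-th coordinate $\mathbb Z^r\to\mathbb Z$. A root associated to $v_i$ is an element $\rho\in\ker\pi=v(M)$ with $v_i(\rho)=-1$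 and $v_j(\rho)\ge0$ for all $j\ne i$. A root $\rho$ is semisimple if $-\rho$ is also a root; it is associated to $(v_i,v_j)$ if $\rho$ is associated to $v_i$ and $-\rho$ to $v_j$. Define $v_i\equiv v_j$ if $v_i=v_j$ or there is a semisimple root associated to $(v_i,v_j)$; this is an equivalence relation on $\Delta_1$. For an equivalence class $F$, $Gl_F$ is the linear group of order $|F|$, acting on $A_C$ by linear substitutions of the variables $\{y_i\}_{v_i\in F}$ and by the identity on the other variables; it is a subgroup of $\mathrm{Aut}_gA_C$. *)

(* Defs.v *)
From HB Require Import structures.
From mathcomp Require Import all_boot all_order all_algebra generic_quotient.
From mathcomp Require Import boolp classical_sets cardinality.
From mathcomp Require Import topology_structure connected.
From mathcomp Require Import mpoly.

Set Implicit Arguments.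
Unset Strict Implicit.
Unset Printing Implicit Defensive.

Import GRing.Theory.
Local Open Scope ring_scope.

(* Over an algebraically closed field k, an affine algebraic group G is       *)
(* determined by its abstract group of points and its coordinate ring k[G],   *)
(* viewed as an algebra of functions G -> k.  The Zariski topology, unipotent *)
(* elements, quotients and isomorphisms below depend only on these data.      *)
Record funGroup (k : fieldType) := FunGroup {
  fg_group :> groupType;
  regular : set (fg_group -> k);
  regular_cst : forall c : k, regular (fun=> c);
  regularD : forall f h, regular f -> regular h -> regular (f \+ h);
  regularM : forall f h, regular f -> regular h -> regular (f \* h);
  regular_mulr : forall f g, regular f -> regular (fun x => f (x * g)%g);
  regular_mull : forall f g, regular f -> regular (fun x => f (g * x)%g);
  regular_inv : forall f, regular f -> regular (fun x => f (x^-1)%g)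
}.

Inductive genAlg (k : fieldType) (T : Type) (S : set (T -> k)) : (T -> k) -> Prop :=
| GenIn f of S f : genAlg S f
| GenCst c : genAlg S (fun=> c)
| GenAdd f h of genAlg S f & genAlg S h : genAlg S (f \+ h)
| GenMul f h of genAlg S f & genAlg S h : genAlg S (f \* h).

Lemma genAlg_comp (k : fieldType) (T U : Type) (S : set (T -> k))
    (S' : set (U -> k)) (a : U -> T) :
  (forall f, S f -> genAlg S' (fun x => f (a x))) ->
  forall f, genAlg S f -> genAlg S' (fun x => f (a x)).
Proof.
move=> Sa f; elim=> {f} [f Sf|c|f h _ Hf _ Hh|f h _ Hf _ Hh].
- exact: Sa.
- exact: GenCst.
- exact: (GenAdd Hf Hh).
- exact: (GenMul Hf Hh).
Qed.

Lemma genAlg_sum (k : fieldType) (T : Type) (S : set (T -> k))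
    (I : Type) (r : seq I) (P : pred I) (F : I -> T -> k) :
  (forall i, P i -> genAlg S (F i)) ->
  genAlg S (fun x => \sum_(i <- r | P i) F i x).
Proof.
move=> SF; elim: r => [|i r IH].
  have -> : (fun x => \sum_(i <- [::] | P i) F i x) = fun=> 0.
    by apply: funext => x; rewrite big_nil.
  exact: GenCst.
have -> : (fun x => \sum_(j <- i :: r | P j) F j x) =
  if P i then F i \+ (fun x => \sum_(j <- r | P j) F j x)
  else (fun x => \sum_(j <- r | P j) F j x).
  by case: ifP => Pi; apply: funext => x; rewrite big_cons Pi.
by case: ifP => // Pi; apply: GenAdd => //; apply: SF.
Qed.

Lemma genAlg_prod (k : fieldType) (T : Type) (S : set (T -> k))
    (I : Type) (r : seq I) (P : pred I) (F : I -> T -> k) :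
  (forall i, P i -> genAlg S (F i)) ->
  genAlg S (fun x => \prod_(i <- r | P i) F i x).
Proof.
move=> SF; elim: r => [|i r IH].
  have -> : (fun x => \prod_(i <- [::] | P i) F i x) = fun=> 1.
    by apply: funext => x; rewrite big_nil.
  exact: GenCst.
have -> : (fun x => \prod_(j <- i :: r | P j) F j x) =
  if P i then F i \* (fun x => \prod_(j <- r | P j) F j x)
  else (fun x => \prod_(j <- r | P j) F j x).
  by case: ifP => Pi; apply: funext => x; rewrite big_cons Pi.
by case: ifP => // Pi; apply: GenMul => //; apply: SF.
Qed.

Definition fg_iso (k : fieldType) (G H : funGroup k) : Prop :=
  exists phi : G -> H,
    [/\ bijective phi,
        {morph phi : x y / (x * y)%g}
      & forall f : H -> k, regular f <-> regular (fun x : G => f (phi x))].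

Section Zariski.
Variables (k : fieldType) (G : funGroup k).

Definition zariski : Type := G.
HB.instance Definition _ := Choice.on zariski.

Definition zariski_open (U : set zariski) : Prop :=
  exists2 S : set (G -> k), (forall f, S f -> regular f)
    & forall g, U g <-> exists2 f, S f & f g != 0.

Lemma zariski_openT : zariski_open setT.
Proof.
exists (fun f => f = fun=> 1); first by move=> _ ->; apply: regular_cst.
by move=> g; split=> // _; exists (fun=> 1) => //; apply: oner_neq0.
Qed.

Lemma zariski_openI : setI_closed zariski_open.
Proof.
move=> U V [S rS US] [T rT VT].
exists (fun f => exists2 a, S a & exists2 b, T b & f = a \* b).
  by move=> _ [a /rS ra [b /rT rb ->]]; apply: regularM.
move=> g; split=> [[/US[a Sa ag] /VT[b Tb bg]]|[_ [a Sa [b Tb ->]]]] /=.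
  by exists (a \* b); [exists a => //; exists b|rewrite /= mulf_neq0].
by rewrite mulf_eq0 negb_or => /andP[ag bg]; split; [apply/US; exists a|apply/VT; exists b].
Qed.

Lemma zariski_open_bigU (I : Type) (f : I -> set zariski) :
  (forall i, zariski_open (f i)) -> zariski_open (\bigcup_i f i)%classic.
Proof.
move=> of_; exists (fun a => regular a /\ exists i, forall g, a g != 0 -> f i g).
  by move=> a [].
move=> g; split=> [[i _ fig]|[a [ra [i ai]] ag]]; last by exists i => //; apply: ai.
have [S rS fS] := of_ i; have [a Sa ag] := (fS g).1 fig.
by exists a => //; split; [apply: rS|exists i => h ah; apply/fS; exists a].
Qed.

HB.instance Definition _ := isOpenTopological.Build zariski
  zariski_openT zariski_openI zariski_open_bigU.

End Zariski.

Lemma zariski_openE (k : fieldType) (G : funGroup k) (U : set (zariski G)) :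
  open U = zariski_open U.
Proof. by []. Qed.

Section Subgroup.
Variables (k : fieldType) (G : funGroup k) (S : groupClosed G).

Definition subg_of : Type := {x : G | x \in (S : {pred G})}.
HB.instance Definition _ := SubChoice.on subg_of.

Lemma subg_group_closed : group_closed (S : {pred G}).
Proof. by split=> [|x y Sx Sy]; rewrite ?gpred1 ?gpredF. Qed.

HB.instance Definition _ := SubChoice_isSubGroup.Build G (S : {pred G}) subg_of subg_group_closed.

End Subgroup.

Section SubFunGroup.
Variables (k : fieldType) (G : funGroup k) (S : groupClosed G).

(* For S closed these are the regular functions of the closed subgroup S. *)
Definition sub_regular (f : subg_of S -> k) : Prop :=
  exists2 h : G -> k, regular h & f = fun x => h (\val x).

Lemma sub_regular_cst c : sub_regular (fun=> c).
Proof. by exists (fun=> c) => //; apply: regular_cst. Qed.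

Lemma sub_regularD f h : sub_regular f -> sub_regular h -> sub_regular (f \+ h).
Proof.
by move=> [a ra ->] [b rb ->]; exists (a \+ b) => //; apply: regularD.
Qed.

Lemma sub_regularM f h : sub_regular f -> sub_regular h -> sub_regular (f \* h).
Proof.
by move=> [a ra ->] [b rb ->]; exists (a \* b) => //; apply: regularM.
Qed.

Lemma sub_regular_mulr f g : sub_regular f -> sub_regular (fun x => f (x * g)%g).
Proof.
by move=> [a ra ->]; exists (fun x => a (x * \val g)%g) => //; apply: regular_mulr.
Qed.

Lemma sub_regular_mull f g : sub_regular f -> sub_regular (fun x => f (g * x)%g).
Proof.
by move=> [a ra ->]; exists (fun x => a (\val g * x)%g) => //; apply: regular_mull.
Qed.

Lemma sub_regular_inv f : sub_regular f -> sub_regular (fun x => f (x^-1)%g).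
Proof.
by move=> [a ra ->]; exists (fun x => a (x^-1)%g) => //; apply: regular_inv.
Qed.

Definition subFunGroup : funGroup k :=
  FunGroup sub_regular_cst sub_regularD sub_regularM
    sub_regular_mulr sub_regular_mull sub_regular_inv.

End SubFunGroup.

Section IdentityComponent.
Variables (k : fieldType) (G : funGroup k).

Definition identity_component_set : set (zariski G) :=
  connected_component setT ((1%g : G) : zariski G).

Definition identity_component_pred : {pred G} :=
  fun x => `[< identity_component_set x >].

Lemma zariski_connected_image (a : zariski G -> zariski G) (A : set (zariski G)) :
    (forall f : G -> k, regular f -> regular (fun x => f (a x))) ->
  connected A -> connected (a @` A)%classic.
Proof.
move=> ra cA.
have oa (U : set (zariski G)) : open U -> open (a @^-1` U)%classic.
  rewrite !zariski_openE => -[S rS US].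
  exists (fun f => exists2 h, S h & f = fun x => h (a x)).
    by move=> _ [h /rS rh ->]; apply: ra.
  move=> g; split; first by move=> /US[f Sf fg]; exists (fun x => f (a x)) => //; exists f.
  by move=> [_ [f Sf ->] fg]; apply/US; exists f.
move=> B [b Bb] [C oC BC] [D cD BD].
have aI (E : set (zariski G)) : B = ((a @` A) `&` E)%classic ->
    (A `&` a @^-1` B = A `&` a @^-1` E)%classic.
  move=> BE; apply/seteqP; split=> x [Ax /=].
    by rewrite BE => -[_ Ex]; split.
  by move=> Ex; split=> //=; rewrite BE; split=> //; exists x.
have AB : (A `&` a @^-1` B)%classic = A.
  apply: cA.
  - have : B b by [].
    rewrite {1}BC => -[[x Ax axb] _].
    by exists x; split=> //=; rewrite axb.
  - by exists (a @^-1` C)%classic; [apply: oa|apply: aI].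
  - exists (a @^-1` D)%classic; last exact: aI.
    by rewrite -[X in closed X]setCK; apply: open_closedC; apply: (oa (~` D)%classic); apply: closed_openC.
apply/seteqP; split=> x; first by rewrite {1}BC => -[].
by move=> [y Ay <-]; move: Ay; rewrite -{1}AB => -[].
Qed.

Lemma identity_component_group_closed : group_closed identity_component_pred.
Proof.
split=> [|x y /asboolP[A [A1 _ cA] Ax] /asboolP[B [B1 _ cB] By]].
  apply/asboolP; apply: connected_component_refl => //.
apply/asboolP.
pose t (z : zariski G) : zariski G := ((z : G) / (y : G))%g.
have rt (f : G -> k) : regular f -> regular (fun z => f (t z)).
  by move=> rf; apply: (regular_mulr _ rf).
exists ((t @` A) `|` (t @` B))%classic; last by left; exists x.
split=> //; first by right; exists y => //; rewrite /t mulgV.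
apply: connectedU; [|exact: zariski_connected_image..].
by exists (t (1%g : G)); split; exists (1%g : G).
Qed.

HB.instance Definition _ := isMulClosed.Build G identity_component_pred
  (group_closedM identity_component_group_closed).
HB.instance Definition _ := isMul1Closed.Build G identity_component_pred
  identity_component_group_closed.1.
HB.instance Definition _ := isInvClosed.Build G identity_component_pred
  (group_closedV identity_component_group_closed).

Definition identity_component : funGroup k :=
  subFunGroup identity_component_pred.

End IdentityComponent.

Record normalSubgroup (G : groupType) := NormalSubgroup {
  ns_group :> groupClosed G;
  ns_normal : forall x y : G, x \in ns_group -> (x ^ y)%g \in ns_group
}.

Section UnipotentRadical.
Variables (k : fieldType) (G : funGroup k).

(* Unipotence of the right translation by g, (rho_g f)(x) = f (x g), on k[G]; *)
(* k[G] is a union of finite-dimensional rho_g-stable subspaces, so this means *)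
(* that rho_g - 1 is locally nilpotent.                                       *)
Definition unipotent (g : G) : Prop :=
  forall f : G -> k, regular f ->
    exists n, iter n (fun (h : G -> k) x => h (x * g)%g - h x) f = (fun=> 0).

Definition connected_unipotent (U : normalSubgroup G) : Prop :=
  let U' : set (zariski G) := fun x => x \in (U : {pred G}) in
  [/\ closed U', connected U' & forall x, U' x -> unipotent x].

Definition is_unipotent_radical (U : normalSubgroup G) : Prop :=
  connected_unipotent U /\
  forall V : normalSubgroup G, connected_unipotent V ->
    {subset (V : {pred G}) <= (U : {pred G})}.

End UnipotentRadical.

Section Quotient.
Variables (k : fieldType) (G : funGroup k) (U : normalSubgroup G).

Definition coset_rel : rel G := fun x y => (x^-1 * y)%g \in (U : {pred G}).

Lemma coset_rel_equiv : equiv_class_of coset_rel.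
Proof.
split=> [x|x y|y x z]; rewrite /coset_rel.
- by rewrite mulVg gpred1.
- by rewrite -gpredV invgM invgK.
- by move=> xy yz; have := gpredM _ _ xy yz; rewrite mulgA mulgK.
Qed.
Canonical coset_equiv := EquivRelPack coset_rel_equiv.

Definition quot_of : Type := {eq_quot coset_equiv}%qT.
HB.instance Definition _ := Choice.on quot_of.
HB.instance Definition _ := EqQuotient.on quot_of.

Definition quot_pi (x : G) : quot_of := (\pi_quot_of x)%qT.

Lemma quot_piP (x y : G) : (quot_pi x = quot_pi y) <-> coset_rel x y.
Proof. by split=> [/eqmodP|xy]; [|apply/eqmodP]. Qed.

Definition quot_mul (X Y : quot_of) : quot_of := quot_pi (repr X * repr Y)%g.
Definition quot_inv (X : quot_of) : quot_of := quot_pi (repr X)^-1%g.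

Lemma quot_repr (X : quot_of) : quot_pi (repr X) = X.
Proof. exact: reprK. Qed.

Lemma quot_mulE x y : quot_mul (quot_pi x) (quot_pi y) = quot_pi (x * y)%g.
Proof.
apply/quot_piP; rewrite /coset_rel.
have /quot_piP hx := quot_repr (quot_pi x).
have /quot_piP hy := quot_repr (quot_pi y).
move: hx hy; rewrite /coset_rel; set a := repr _; set b := repr _ => hx hy.
have -> : ((a * b)^-1 * (x * y) = (a^-1 * x) ^ b * (b^-1 * y))%g.
  by rewrite conjgE invgM !mulgA mulgK.
by apply: gpredM => //; apply: ns_normal.
Qed.

Lemma quot_invE x : quot_inv (quot_pi x) = quot_pi (x^-1)%g.
Proof.
apply/quot_piP; rewrite /coset_rel.
have /quot_piP := quot_repr (quot_pi x).
rewrite /coset_rel; set a := repr _ => hx.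
have -> : (a^-1^-1 * x^-1 = ((a^-1 * x)^-1) ^ (a^-1))%g.
  by rewrite conjgE !invgM !invgK !mulgA mulgK.
by apply: ns_normal; rewrite gpredV.
Qed.

Lemma quot_mulA : associative quot_mul.
Proof.
move=> X Y Z; rewrite -(quot_repr X) -(quot_repr Y) -(quot_repr Z).
by rewrite !quot_mulE mulgA.
Qed.
Lemma quot_mul1 : left_id (quot_pi 1%g) quot_mul.
Proof. by move=> X; rewrite -(quot_repr X) quot_mulE mul1g. Qed.
Lemma quot_mulr1 : right_id (quot_pi 1%g) quot_mul.
Proof. by move=> X; rewrite -(quot_repr X) quot_mulE mulg1. Qed.
Lemma quot_mulV : left_inverse (quot_pi 1%g) quot_inv quot_mul.
Proof. by move=> X; rewrite -(quot_repr X) quot_invE quot_mulE mulVg. Qed.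
Lemma quot_mulrV : right_inverse (quot_pi 1%g) quot_inv quot_mul.
Proof. by move=> X; rewrite -(quot_repr X) quot_invE quot_mulE mulgV. Qed.

HB.instance Definition _ := isGroup.Build quot_of
  quot_mulA quot_mul1 quot_mulr1 quot_mulV quot_mulrV.

(* k[G/U] = k[G]^U *)
Definition quot_regular (f : quot_of -> k) : Prop :=
  regular (fun x : G => f (quot_pi x)).

Lemma quot_piM x y : quot_pi (x * y)%g = (quot_pi x * quot_pi y)%g.
Proof. by rewrite -quot_mulE. Qed.
Lemma quot_piV x : quot_pi (x^-1)%g = ((quot_pi x)^-1)%g.
Proof. by rewrite -quot_invE. Qed.

Lemma quot_regular_mulr f g : quot_regular f -> quot_regular (fun X => f (X * g)%g).
Proof.
move=> /(regular_mulr (repr g)); rewrite /quot_regular; congr regular.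
by apply: funext => x; rewrite quot_piM quot_repr.
Qed.

Lemma quot_regular_mull f g : quot_regular f -> quot_regular (fun X => f (g * X)%g).
Proof.
move=> /(regular_mull (repr g)); rewrite /quot_regular; congr regular.
by apply: funext => x; rewrite quot_piM quot_repr.
Qed.

Lemma quot_regular_inv f : quot_regular f -> quot_regular (fun X => f (X^-1)%g).
Proof.
move=> /regular_inv; rewrite /quot_regular; congr regular.
by apply: funext => x; rewrite quot_piV.
Qed.

Definition quotFunGroup : funGroup k := @FunGroup k quot_of quot_regular
  (fun c => regular_cst G c)
  (fun f h rf rh => regularD rf rh)
  (fun f h rf rh => regularM rf rh)
  quot_regular_mulr quot_regular_mull quot_regular_inv.

End Quotient.

Section Product.
Variables (k : fieldType) (I : finType) (G : I -> funGroup k).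

Definition prod_of : Type := {dffun forall i : I, G i}.
HB.instance Definition _ := Choice.on prod_of.

Definition prod_one : prod_of := [ffun i => 1%g].
Definition prod_inv (x : prod_of) : prod_of := [ffun i => (x i)^-1%g].
Definition prod_mul (x y : prod_of) : prod_of := [ffun i => (x i * y i)%g].

Lemma prod_mulA : associative prod_mul.
Proof. by move=> x y z; apply/ffunP => i; rewrite !ffunE mulgA. Qed.
Lemma prod_mul1 : left_id prod_one prod_mul.
Proof. by move=> x; apply/ffunP => i; rewrite !ffunE mul1g. Qed.
Lemma prod_mulr1 : right_id prod_one prod_mul.
Proof. by move=> x; apply/ffunP => i; rewrite !ffunE mulg1. Qed.
Lemma prod_mulV : left_inverse prod_one prod_inv prod_mul.
Proof. by move=> x; apply/ffunP => i; rewrite !ffunE mulVg. Qed.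
Lemma prod_mulrV : right_inverse prod_one prod_inv prod_mul.
Proof. by move=> x; apply/ffunP => i; rewrite !ffunE mulgV. Qed.

HB.instance Definition _ := isGroup.Build prod_of
  prod_mulA prod_mul1 prod_mulr1 prod_mulV prod_mulrV.

Definition prod_gens (f : prod_of -> k) : Prop :=
  exists i, exists2 h : G i -> k, regular h & f = fun x => h (x i).

Definition prod_regular : set (prod_of -> k) := genAlg prod_gens.

Lemma prod_regular_mulr f g : prod_regular f -> prod_regular (fun x => f (x * g)%g).
Proof.
apply: genAlg_comp => {}f [i [h rh ->]]; apply: GenIn; exists i.
exists (fun x => h (x * g i)%g); first exact: regular_mulr.
by apply: funext => x; rewrite ffunE.
Qed.

Lemma prod_regular_mull f g : prod_regular f -> prod_regular (fun x => f (g * x)%g).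
Proof.
apply: genAlg_comp => {}f [i [h rh ->]]; apply: GenIn; exists i.
exists (fun x => h (g i * x)%g); first exact: regular_mull.
by apply: funext => x; rewrite ffunE.
Qed.

Lemma prod_regular_inv f : prod_regular f -> prod_regular (fun x => f (x^-1)%g).
Proof.
apply: genAlg_comp => {}f [i [h rh ->]]; apply: GenIn; exists i.
exists (fun x => h (x^-1)%g); first exact: regular_inv.
by apply: funext => x; rewrite ffunE.
Qed.

Definition prodFunGroup : funGroup k := @FunGroup k prod_of prod_regular
  (@GenCst _ _ _) (@GenAdd _ _ _) (@GenMul _ _ _)
  prod_regular_mulr prod_regular_mull prod_regular_inv.

End Product.

Section GL.
Variables (k : fieldType) (n : nat).

Definition gl_of : Type := {A : 'M[k]_n | A \in unitmx}.
HB.instance Definition _ := SubChoice.on gl_of.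

Definition gl_one : gl_of := exist _ 1%:M (unitmx1 k n).
Definition gl_inv (A : gl_of) : gl_of :=
  exist _ (invmx (\val A)) (etrans (unitmx_inv _) (valP A)).
Lemma gl_mul_subproof (A B : gl_of) : \val A *m \val B \in unitmx.
Proof. by rewrite unitmx_mul (valP A) (valP B). Qed.
Definition gl_mul (A B : gl_of) : gl_of := exist _ (\val A *m \val B) (gl_mul_subproof A B).

Lemma gl_mulA : associative gl_mul.
Proof. by move=> A B C; apply: val_inj; rewrite /= mulmxA. Qed.
Lemma gl_mul1 : left_id gl_one gl_mul.
Proof. by move=> A; apply: val_inj; rewrite /= mul1mx. Qed.
Lemma gl_mulr1 : right_id gl_one gl_mul.
Proof. by move=> A; apply: val_inj; rewrite /= mulmx1. Qed.
Lemma gl_mulV : left_inverse gl_one gl_inv gl_mul.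
Proof. by move=> A; apply: val_inj; rewrite /= mulVmx // (valP A). Qed.
Lemma gl_mulrV : right_inverse gl_one gl_inv gl_mul.
Proof. by move=> A; apply: val_inj; rewrite /= mulmxV // (valP A). Qed.

HB.instance Definition _ := isGroup.Build gl_of
  gl_mulA gl_mul1 gl_mulr1 gl_mulV gl_mulrV.

Definition gl_gens (f : gl_of -> k) : Prop :=
  (exists i j, f = fun A => \val A i j) \/ f = fun A => (\det (\val A))^-1.

Definition gl_regular : set (gl_of -> k) := genAlg gl_gens.

Lemma gl_regular_entry i j : gl_regular (fun A => \val A i j).
Proof. by apply: GenIn; left; exists i, j. Qed.

Lemma gl_regular_detV : gl_regular (fun A => (\det (\val A))^-1).
Proof. by apply: GenIn; right. Qed.

Lemma gl_regular_det (m : nat) (B : gl_of -> 'M[k]_m) :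
  (forall i j, gl_regular (fun A => B A i j)) -> gl_regular (fun A => \det (B A)).
Proof.
move=> rB; apply: genAlg_sum => s _.
by apply: (GenMul (GenCst _ _)); apply: genAlg_prod => i _; apply: rB.
Qed.

Lemma gl_regular_mulr f g : gl_regular f -> gl_regular (fun x => f (x * g)%g).
Proof.
apply: genAlg_comp => {}f [[i [j ->]]|->].
  have -> : (fun x : gl_of => \val (x * g)%g i j) =
            (fun x => \sum_l \val x i l * \val g l j).
    by apply: funext => x; rewrite [LHS]mxE.
  by apply: genAlg_sum => l _; apply: (GenMul (gl_regular_entry _ _) (GenCst _ _)).
have -> : (fun x : gl_of => (\det (\val (x * g)%g))^-1) =
          (fun x => (\det (\val x))^-1) \* (fun=> (\det (\val g))^-1).
  by apply: funext => x; rewrite /= det_mulmx invfM.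
exact: (GenMul gl_regular_detV (GenCst _ _)).
Qed.

Lemma gl_regular_mull f g : gl_regular f -> gl_regular (fun x => f (g * x)%g).
Proof.
apply: genAlg_comp => {}f [[i [j ->]]|->].
  have -> : (fun x : gl_of => \val (g * x)%g i j) =
            (fun x => \sum_l \val g i l * \val x l j).
    by apply: funext => x; rewrite [LHS]mxE.
  by apply: genAlg_sum => l _; apply: (GenMul (GenCst _ _) (gl_regular_entry _ _)).
have -> : (fun x : gl_of => (\det (\val (g * x)%g))^-1) =
          (fun=> (\det (\val g))^-1) \* (fun x => (\det (\val x))^-1).
  by apply: funext => x; rewrite /= det_mulmx invfM.
exact: (GenMul (GenCst _ _) gl_regular_detV).
Qed.

Lemma gl_regular_inv f : gl_regular f -> gl_regular (fun x => f (x^-1)%g).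
Proof.
apply: genAlg_comp => {}f [[i [j ->]]|->].
  have -> : (fun x : gl_of => \val (x^-1)%g i j) =
     (fun x => (\det (\val x))^-1) \*
     ((fun=> (-1) ^+ (j + i)) \* (fun x => \det (row' j (col' i (\val x))))).
    by apply: funext => x; rewrite /= /invmx (valP x) !mxE.
  apply: (GenMul gl_regular_detV); apply: (GenMul (GenCst _ _)).
  apply: gl_regular_det => a b.
  have -> : (fun A : gl_of => row' j (col' i (\val A)) a b) =
            (fun A : gl_of => \val A (fintype.lift j a) (fintype.lift i b)).
    by apply: funext => A; rewrite !mxE.
  exact: gl_regular_entry.
have -> : (fun x : gl_of => (\det (\val (x^-1)%g))^-1) = (fun x => \det (\val x)).
  by apply: funext => x; rewrite /= det_inv invrK.
by apply: gl_regular_det => i j; apply: gl_regular_entry.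
Qed.

Definition GL : funGroup k := @FunGroup k gl_of gl_regular
  (@GenCst _ _ _) (@GenAdd _ _ _) (@GenMul _ _ _)
  gl_regular_mulr gl_regular_mull gl_regular_inv.

End GL.

(* M = Z^d is written as row vectors and M^* = Hom(M, Z) as column vectors,   *)
(* the value of v : M^* at m : M being the entry of m *m v.                   *)
Section Fans.
Variable d : nat.

Definition pairing (m : 'rV[int]_d) (v : 'cV[int]_d) : int := (m *m v) 0 0.

Definition cone_of (s : seq 'cV[int]_d) : set 'cV[rat]_d := fun x =>
  exists2 c : 'I_(size s) -> rat, (forall i, 0 <= c i)
    & x = \sum_i c i *: map_mx intr s`_i.

Definition strongly_convex (sigma : set 'cV[rat]_d) : Prop :=
  forall x, sigma x -> sigma (- x) -> x = 0.

Definition is_face (tau sigma : set 'cV[rat]_d) : Prop :=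
  exists2 u : 'rV[rat]_d, (forall x, sigma x -> 0 <= (u *m x) 0 0)
    & forall x, tau x <-> sigma x /\ (u *m x) 0 0 = 0.

Record is_fan (Delta : set (set 'cV[rat]_d)) : Prop := IsFan {
  fan_finite : finite_set Delta;
  fan_cone : forall sigma, Delta sigma ->
    strongly_convex sigma /\ exists s, sigma = cone_of s;
  fan_face : forall sigma tau, Delta sigma -> is_face tau sigma -> Delta tau;
  fan_meet : forall sigma tau, Delta sigma -> Delta tau ->
    is_face (sigma `&` tau)%classic sigma
}.

Definition is_complete (Delta : set (set 'cV[rat]_d)) : Prop :=
  forall x, exists2 sigma, Delta sigma & sigma x.

(* A ray is identified with its primitive generator, an epimorphism M -> Z.   *)
Definition is_ray (Delta : set (set 'cV[rat]_d)) (v : 'cV[int]_d) : Prop :=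
  (forall a : int, exists m, pairing m v = a) /\ Delta (cone_of [:: v]).

Definition rays_map (r : nat) (v : 'I_r -> 'cV[int]_d) (m : 'rV[int]_d) : 'rV[int]_r :=
  \row_i pairing m (v i).

(* Exactness of 0 -> M -> Z^r -> N -> 0; it determines (N, pi), the Weil      *)
(* divisor class group with pi n = [\sum_i n_i H_i], up to isomorphism.       *)
Record is_class_group (r : nat) (v : 'I_r -> 'cV[int]_d)
    (N : zmodType) (pi : {additive 'rV[int]_r -> N}) : Prop := IsClassGroup {
  class_group_inj : injective (rays_map v);
  class_group_exact : forall n, pi n = 0 <-> exists m, n = rays_map v m;
  class_group_surj : forall a : N, exists n, pi n = a
}.

End Fans.

Section Roots.
Variables (r : nat) (N : zmodType) (pi : {additive 'rV[int]_r -> N}).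

Definition is_root (i : 'I_r) (rho : 'rV[int]_r) : Prop :=
  [/\ pi rho = 0, rho 0 i = -1 & forall j, j != i -> 0 <= rho 0 j].

Definition semisimple_root (i j : 'I_r) (rho : 'rV[int]_r) : Prop :=
  is_root i rho /\ is_root j (- rho).

Definition ray_equiv (i j : 'I_r) : Prop :=
  i = j \/ exists rho, semisimple_root i j rho.

Definition is_equiv_class (A : {set 'I_r}) : Prop :=
  exists i, forall j, (j \in A) <-> ray_equiv i j.

End Roots.

Section GradedAut.
Variables (k : fieldType) (r : nat) (N : zmodType) (pi : {additive 'rV[int]_r -> N}).

Definition degN (m : 'X_{1..r}) : N := pi (\row_i (m i)%:Z).

Definition homogeneous (a : N) (p : {mpoly k[r]}) : Prop :=
  forall m, m \in msupp p -> degN m = a.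

Record gaut := GAut {
  gaut_fun :> {lrmorphism {mpoly k[r]} -> {mpoly k[r]}};
  gaut_inv : {lrmorphism {mpoly k[r]} -> {mpoly k[r]}};
  gaut_invK : cancel gaut_fun gaut_inv;
  gaut_funK : cancel gaut_inv gaut_fun;
  gaut_graded : forall a p, homogeneous a p -> homogeneous a (gaut_fun p);
  gaut_inv_graded : forall a p, homogeneous a p -> homogeneous a (gaut_inv p)
}.

Lemma lrmorphism_ext (f g : {lrmorphism {mpoly k[r]} -> {mpoly k[r]}}) :
  f =1 g -> f = g.
Proof.
case: f => f [[[f0 fD]] [[f1 fM]] [fZ]]; case: g => g [[[g0 gD]] [[g1 gM]] [gZ]] /= /funext fg.
subst g; rewrite (Prop_irrelevance fZ gZ) (Prop_irrelevance f1 g1).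
by rewrite (Prop_irrelevance fM gM) (Prop_irrelevance f0 g0) (Prop_irrelevance fD gD).
Qed.

Lemma gaut_ext (f g : gaut) : f =1 g -> f = g.
Proof.
case: f => f f' fK f'K fgr f'gr; case: g => g g' gK g'K ggr g'gr /= fg.
have {fg} E : f = g by apply: lrmorphism_ext.
subst g; have E : f' = g'.
  by apply: lrmorphism_ext => p; rewrite -{1}(g'K p) fK.
subst g'; congr GAut; exact: Prop_irrelevance.
Qed.

HB.instance Definition _ := gen_eqMixin gaut.
HB.instance Definition _ := gen_choiceMixin gaut.

Definition gaut_one : gaut := @GAut idfun idfun
  (fun=> erefl) (fun=> erefl) (fun _ _ h => h) (fun _ _ h => h).

Definition gaut_V (f : gaut) : gaut :=
  GAut (@gaut_funK f) (@gaut_invK f) (@gaut_inv_graded f) (@gaut_graded f).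

Definition gaut_mul (f g : gaut) : gaut :=
  @GAut (f \o g) (gaut_inv g \o gaut_inv f)
    (can_comp (@gaut_invK f) (@gaut_invK g))
    (can_comp (@gaut_funK g) (@gaut_funK f))
    (fun a p hp => gaut_graded (gaut_graded hp))
    (fun a p hp => gaut_inv_graded (gaut_inv_graded hp)).

Lemma gaut_mulA : associative gaut_mul.
Proof. by move=> f g h; apply: gaut_ext. Qed.
Lemma gaut_mul1 : left_id gaut_one gaut_mul.
Proof. by move=> f; apply: gaut_ext. Qed.
Lemma gaut_mulr1 : right_id gaut_one gaut_mul.
Proof. by move=> f; apply: gaut_ext. Qed.
Lemma gaut_mulV : left_inverse gaut_one gaut_V gaut_mul.
Proof. by move=> f; apply: gaut_ext => p /=; rewrite gaut_invK. Qed.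
Lemma gaut_mulrV : right_inverse gaut_one gaut_V gaut_mul.
Proof. by move=> f; apply: gaut_ext => p /=; rewrite gaut_funK. Qed.

HB.instance Definition _ := isGroup.Build gaut
  gaut_mulA gaut_mul1 gaut_mulr1 gaut_mulV gaut_mulrV.

(* The coordinate ring of Aut_g A_C is generated by the matrix coefficients   *)
(* l (f p) and l (f^-1 p), for p in A_C and l a linear form on A_C.  When the *)
(* graded pieces of A_C are finite-dimensional (X complete), this is the      *)
(* coordinate ring of Aut_g A_C as a closed subgroup of GL(V), for V the sum  *)
(* of the graded pieces containing y_1, ..., y_r.                             *)
Definition gaut_gens (F : gaut -> k) : Prop :=
  exists (p : {mpoly k[r]}) (l : {scalar {mpoly k[r]}}),
    F = (fun f => l (f p)) \/ F = (fun f => l (gaut_inv f p)).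

Definition gaut_regular : set (gaut -> k) := genAlg gaut_gens.

Lemma gaut_regular_mulr F g :
  gaut_regular F -> gaut_regular (fun f => F (f * g)%g).
Proof.
apply: genAlg_comp => {}F [p [l [->|->]]]; apply: GenIn.
  by exists (g p), l; left.
by exists p, (l \o gaut_inv g); right.
Qed.

Lemma gaut_regular_mull F g :
  gaut_regular F -> gaut_regular (fun f => F (g * f)%g).
Proof.
apply: genAlg_comp => {}F [p [l [->|->]]]; apply: GenIn.
  by exists p, (l \o g); left.
by exists (gaut_inv g p), l; right.
Qed.

Lemma gaut_regular_inv F : gaut_regular F -> gaut_regular (fun f => F (f^-1)%g).
Proof.
apply: genAlg_comp => {}F [p [l [->|->]]]; apply: GenIn; exists p, l.
  by right.
by left.
Qed.

Definition Autg : funGroup k := @FunGroup k gaut gaut_regular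
  (@GenCst _ _ _) (@GenAdd _ _ _) (@GenMul _ _ _)
  gaut_regular_mulr gaut_regular_mull gaut_regular_inv.

End GradedAut.

(* Main.v *)
(* If [m] in [M] pairs nonnegatively with every ray then [m = 0], because the rays *)
(* of a complete fan generate the whole space as a cone; dually the rays satisfy a *)
(* linear relation with positive coefficients, and these coefficients are weights  *)
(* of the [y_i] that factor through the class group [N].  So a graded automorphism *)
(* [f] has no constant terms, [f y_i = L_i + Q_i] with [L_i] linear and [Q_i] of   *)
(* order at least 2, and [f |-> L] is multiplicative.  Since [rho = e_j - e_i] for *)
(* a semisimple root, [v_i ~ v_j] means [deg y_i = deg y_j], so [L] is an arbitrary *)
(* invertible matrix with one block per class, and [f |-> L] is split by linear    *)
(* substitutions.  Its kernel is unipotent (finite-dimensional graded pieces,      *)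
(* filtered by total degree) and connected (contract it by [y |-> t y]), whence    *)
(* [Aut_g A_C] is itself connected.  The kernel is the largest normal connected    *)
(* unipotent subgroup, since no nontrivial normal subgroup of a product of GL's    *)
(* consists of unipotent matrices.                                                 *)
Require Import Defs.
From HB Require Import structures.
From mathcomp Require Import all_boot all_order all_algebra.
From mathcomp Require Import boolp classical_sets.
From mathcomp Require Import topology_structure connected.
From mathcomp Require Import mpoly.
From mathcomp Require Import lra.

Set Implicit Arguments.
Unset Strict Implicit.
Unset Printing Implicit Defensive.

Import Order.TTheory GRing.Theory Num.Theory.
Local Open Scope ring_scope.

(** * Cones and fans *)

(** The proof studies the representation [linpart], the action of a graded automorphism on m/m^2,
    where m is the ideal generated by the variables. Completeness of the fan enters through
    [class_group_weight]: there are weights at least 1 on the variables such that the weight of a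
    monomial depends only on its degree in [N]. Hence only constants have degree 0 ([weight_deg0]),
    so automorphisms preserve m and [linpart] is multiplicative; and total degree is bounded on each
    graded piece ([weight_deg_bound]), so the kernel of [linpart] is unipotent ([linpart1_locnil]).
    By [ray_equivE] two variables are equivalent exactly when they have the same degree. The image
    of [linpart] is therefore the product of the groups Gl_F, and [lin_section] is a splitting.

    Connectedness is obtained from rational curves ([connected_rational_path]). Conjugation by
    scalings contracts each element of the kernel to 1 ([unipotent_path]), and each element of the
    product of the Gl_F is joined to 1 by a segment ([section_identity_component]). So the identity
    component is the whole group, and the kernel is a closed connected normal unipotent subgroup. It
    is the largest one: a unipotent linear part other than 1 has a nonzero off-diagonal entry, and
    then its product with a suitable conjugate under a transvection has the wrong trace to be
    unipotent ([normal_unipotent_trivial]). The quotient by the kernel is identified with the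
    product in [radical_quotient_iso]. *)

Section Gordan.
Variables (K : realFieldType) (d : nat).
Implicit Types (u : 'rV[K]_d) (x : 'cV[K]_d).

Definition dot u x : K := (u *m x) 0 0.

Lemma dotDl u u' x : dot (u + u') x = dot u x + dot u' x.
Proof. by rewrite /dot mulmxDl mxE. Qed.
Lemma dotZl a u x : dot (a *: u) x = a * dot u x.
Proof. by rewrite /dot -scalemxAl mxE. Qed.
Lemma dotDr u x x' : dot u (x + x') = dot u x + dot u x'.
Proof. by rewrite /dot mulmxDr mxE. Qed.
Lemma dotZr a u x : dot u (a *: x) = a * dot u x.
Proof. by rewrite /dot -scalemxAr mxE. Qed.
Lemma dot0r u : dot u 0 = 0.
Proof. by rewrite /dot mulmx0 mxE. Qed.

Lemma dot_eq1 x : x != 0 -> exists u, dot u x = 1.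
Proof.
move=> x0; have [i xi] : exists i, x i 0 != 0.
  apply/existsP; apply: contraNT x0; rewrite negb_exists => /forallP x0.
  apply/eqP/matrixP => i j; rewrite ord1 mxE; apply/eqP.
  by have := x0 i; rewrite negbK.
exists ((x i 0)^-1 *: delta_mx 0 i).
by rewrite dotZl /dot -rowE mxE mulVf.
Qed.

Lemma small_perturbation n (a b : 'I_n -> K) : (forall i, 0 < a i) ->
  exists2 e, 0 < e & forall i, 0 < a i + e * b i.
Proof.
move=> a0; pose S := 1 + \sum_i `|b i| / a i.
have S0 : 0 < S.
  rewrite ltr_pwDl // sumr_ge0 // => i _.
  by rewrite divr_ge0 // ltW.
exists S^-1 => [|i]; first by rewrite invr_gt0.
rewrite -(pmulr_rgt0 _ S0) mulrDr mulrA mulfV ?gt_eqF // mul1r.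
have : `|b i| < S * a i.
  rewrite -ltr_pdivrMr // /S (bigD1 i) //= addrCA ltrDl.
  rewrite ltr_pwDl // sumr_ge0 // => j _.
  by rewrite divr_ge0 // ltW.
by have := ler_norm (- b i); rewrite normrN; lra.
Qed.

(** Gordan's alternative, by eliminating one vector [b] at a time. The only hard case is a
    functional [u] positive on the other vectors and negative on [b]; those vectors are then moved
    along [b] into the hyperplane where [u] vanishes. *)
Theorem gordan n (a : 'I_n -> 'cV[K]_d) :
  (exists u, forall i, 0 < dot u (a i)) \/
  (exists c : 'I_n -> K, [/\ forall i, 0 <= c i, exists i, 0 < c i
     & \sum_i c i *: a i = 0]).
Proof.
elim: n a => [|n IH] a; first by left; exists 0 => -[].
set b := a ord0; set a' := fun i => a (fintype.lift ord0 i).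
(* A functional that is positive on the other vectors and zero on a nonzero [b] becomes positive on
   all of them after a small push towards some [w] with [dot w b = 1]. *)
have on_boundary u : b != 0 -> (forall i, 0 < dot u (a' i)) -> dot u b = 0 ->
    exists u, forall i, 0 < dot u (a i).
  move=> /dot_eq1[w wb] ua ub.
  have [e e0 ea] := small_perturbation (fun i => dot w (a' i)) ua.
  exists (u + e *: w) => i; rewrite dotDl dotZl.
  case: (unliftP ord0 i) => [j ->|->]; first exact: ea.
  by rewrite ub wb add0r mulr1.
have [[u ua]|[c [c0 [i ci] ca]]] := IH a'; last first.
  right; exists (fun j => if unlift ord0 j is Some l then c l else 0); split.
  - by move=> j; case: unlift.
  - by exists (fintype.lift ord0 i); rewrite liftK.
  rewrite big_ord_recl unlift_none scale0r add0r -[RHS]ca.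
  by apply: eq_bigr => j _; rewrite liftK.
case: (ltrgtP (dot u b) 0) => [ub|ub|ub].
(* The coefficient [la i] is positive and chosen so that [u] vanishes on [a' i + la i *: b]. *)
- pose la i := - dot u (a' i) / dot u b.
  have la0 i : 0 < la i by rewrite /la mulNr -mulrN -invrN divr_gt0 ?oppr_gt0.
  have lab i : la i * dot u b = - dot u (a' i).
    by rewrite /la mulfVK // lt_eqF.
  have b0 : b != 0 by apply: contraTneq ub => ->; rewrite dot0r ltxx.
  have [[u' u'a]|[c [c0 [i ci] ca]]] := IH (fun i => a' i + la i *: b).
    (* Adding [t *: u] makes [u'] vanish on [b]; its value on [a' i] becomes that of [u'] on
       [a' i + la i *: b]. *)
    left; pose t := - dot u' b / dot u b.
    have tb : t * dot u b = - dot u' b by rewrite /t mulfVK // lt_eqF.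
    apply: (on_boundary (u' + t *: u)) => // [i|].
      have := u'a i; rewrite !dotDr !dotZr dotDl dotZl.
      have -> : t * dot u (a' i) = la i * dot u' b.
        by apply: oppr_inj; rewrite -!mulrN -lab mulrCA tb.
      by [].
    by rewrite dotDl dotZl tb addrN.
  right; exists (fun j => if unlift ord0 j is Some l then c l
                          else \sum_l c l * la l); split.
  - move=> j; case: unlift => // ; apply: sumr_ge0 => l _.
    by rewrite mulr_ge0 // ltW.
  - by exists (fintype.lift ord0 i); rewrite liftK.
  rewrite big_ord_recl unlift_none scaler_suml -big_split /= -[RHS]ca.
  by apply: eq_bigr => j _; rewrite liftK scalerDr scalerA addrC.
- left; exists u => i.
  by case: (unliftP ord0 i) => [j ->|->]; first exact: ua.
- have [b0|b0] := eqVneq b 0; last by left; apply: on_boundary ub.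
  right; exists (fun i => (i == ord0)%:R); split.
  - by move=> i; rewrite ler0n.
  - by exists ord0.
  rewrite big_ord_recl -/b b0 scaler0 add0r big1 // => i _.
  by rewrite scale0r.
Qed.

End Gordan.

Section Cones.
Variable d : nat.
Implicit Types (s : seq 'cV[int]_d) (w : 'cV[int]_d) (x y : 'cV[rat]_d).

Local Notation toQ w := (map_mx (intr : int -> rat) w).

Lemma cone_of0 s : cone_of s 0.
Proof. by exists (fun=> 0) => //; rewrite big1 // => i _; rewrite scale0r. Qed.

Lemma cone_ofD s x y : cone_of s x -> cone_of s y -> cone_of s (x + y).
Proof.
move=> [a a0 ->] [b b0 ->]; exists (fun i => a i + b i) => [i|].
  by rewrite addr_ge0.
by rewrite -big_split /=; apply: eq_bigr => i _; rewrite scalerDl.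
Qed.

Lemma cone_ofZ s (e : rat) x : 0 <= e -> cone_of s x -> cone_of s (e *: x).
Proof.
move=> e0 [a a0 ->]; exists (fun i => e * a i) => [i|].
  by rewrite mulr_ge0.
by rewrite scaler_sumr; apply: eq_bigr => i _; rewrite scalerA.
Qed.

Lemma cone_of_mem s w : w \in s -> cone_of s (toQ w).
Proof.
rewrite -index_mem => ws; exists (fun i => (i == Ordinal ws)%:R) => [i|].
  by rewrite ler0n.
rewrite (bigD1 (Ordinal ws)) //= eqxx scale1r nth_index -?index_mem //.
by rewrite big1 ?addr0 // => i /negPf ->; rewrite scale0r.
Qed.

Lemma cone_of_ind s (P : 'cV[rat]_d -> Prop) :
    P 0 -> (forall x y, P x -> P y -> P (x + y)) ->
    (forall e x, 0 <= e -> P x -> P (e *: x)) ->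
    (forall w, w \in s -> P (toQ w)) ->
  forall x, cone_of s x -> P x.
Proof.
move=> P0 PD PZ Ps x [c c0 ->]; elim/big_ind: _ => // i _.
by apply: PZ => //; apply: Ps; apply: mem_nth.
Qed.

Lemma cone_of_sub s t : {subset s <= t} -> forall x, cone_of s x -> cone_of t x.
Proof.
move=> st; apply: cone_of_ind => [|x y|e x|w /st].
- exact: cone_of0.
- exact: cone_ofD.
- exact: cone_ofZ.
- exact: cone_of_mem.
Qed.

Lemma cone_of1Z (g : int) w : 0 < g -> cone_of [:: g *: w] = cone_of [:: w].
Proof.
move=> g0; have gw : toQ (g *: w) = g%:~R *: toQ w.
  by apply/matrixP => i j; rewrite !mxE intrM.
have g0' : 0 < g%:~R :> rat by rewrite ltr0z.
apply/seteqP; split; apply: cone_of_ind.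
- exact: cone_of0.
- exact: cone_ofD.
- exact: cone_ofZ.
- move=> _ /[1!inE] /eqP ->; rewrite gw; apply: cone_ofZ; first exact: ltW.
  by apply: cone_of_mem; rewrite inE.
- exact: cone_of0.
- exact: cone_ofD.
- exact: cone_ofZ.
- move=> _ /[1!inE] /eqP ->.
  have -> : toQ w = g%:~R^-1 *: toQ (g *: w).
    by rewrite gw scalerA mulVf ?scale1r // gt_eqF.
  apply: cone_ofZ; first by rewrite invr_ge0 ltW.
  by apply: cone_of_mem; rewrite inE.
Qed.

Definition irredundant s :=
  forall w, w \in s -> ~ cone_of (rem w s) (toQ w).

(** A generating list of minimal length works, since a redundant generator could be removed. *)
Lemma irredundant_cone s : exists2 t, cone_of t = cone_of s & irredundant t.
Proof.
pose P n := `[< exists2 t, cone_of t = cone_of s & size t = n >].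
have exP : exists n, P n by exists (size s); apply/asboolP; exists s.
case: (ex_minnP exP) => n /asboolP[t ts tn] n_min; exists t => // w wt wr.
have : cone_of (rem w t) = cone_of s.
  rewrite -ts; apply/seteqP; split; first by apply: cone_of_sub; apply: mem_rem.
  apply: cone_of_ind => [|x y|e x|z].
  - exact: cone_of0.
  - exact: cone_ofD.
  - exact: cone_ofZ.
  - rewrite (perm_mem (perm_to_rem wt)) inE => /predU1P[->//|].
    exact: cone_of_mem.
move=> rs; have : P (size (rem w t)) by apply/asboolP; exists (rem w t).
by move/n_min; rewrite size_rem // tn; case: (n) tn => [|m _]; [case: (t) wt|rewrite ltnn].
Qed.

(** Project along [w] and apply [gordan] to the images of the other generators. A functional
    positive on all of them pulls back to one that supports the cone exactly along the ray of [w]. A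
    nonnegative relation among them contradicts either irredundancy or strong convexity. *)
Lemma irredundant_face s w : strongly_convex (cone_of s) -> irredundant s ->
  w \in s -> is_face (cone_of [:: w]) (cone_of s).
Proof.
move=> sc irr ws; have nz z : z \in s -> toQ z != 0.
  by move=> zs; apply/eqP => z0; apply: (irr z zs); rewrite z0; apply: cone_of0.
have [l lw] := dot_eq1 (nz w ws).
set t := rem w s; have ts z : z \in t -> z \in s by apply: mem_rem.
pose p x := x - dot l x *: toQ w.
have [[u ut]|[c [c0 [j cj] ct]]] := gordan (fun i : 'I_(size t) => p (toQ t`_i)).
  (* This is [u] composed with the projection [p]. *)
  pose u' := u - dot u (toQ w) *: l.
  have u'E x : dot u' x = dot u (p x).
    by rewrite /u' /p dotDl dotDr -!scaleNr dotZl dotZr; lra.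
  have u'w : dot u' (toQ w) = 0 by rewrite u'E /p lw scale1r subrr dot0r.
  have face x : cone_of s x -> 0 <= dot u' x /\ (dot u' x = 0 -> cone_of [:: w] x).
    move: x; apply: cone_of_ind => [|x y [x0 xw] [y0 yw]|e x|z].
    - by rewrite dot0r; split=> // _; apply: cone_of0.
    - rewrite dotDr; split=> [|xy]; first exact: addr_ge0.
      by apply: cone_ofD; [apply: xw|apply: yw]; lra.
    - rewrite le_eqVlt => /predU1P[<-|e0] [x0 xw].
        by rewrite scale0r dot0r; split=> // _; apply: cone_of0.
      rewrite dotZr; split=> [|/eqP]; first by rewrite mulr_ge0 // ltW.
      rewrite mulf_eq0 gt_eqF //= => /eqP /xw.
      by apply: cone_ofZ; apply: ltW.
    - rewrite (perm_mem (perm_to_rem ws)) inE => /predU1P[->|].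
        by rewrite u'w; split=> // _; apply: cone_of_mem; rewrite inE.
      move=> /(nthP 0)[i it <-]; have := ut (Ordinal it); rewrite -u'E => u'i.
      by split=> [|u'0]; [exact: ltW|move: u'i; rewrite /= u'0 ltxx].
  exists u' => [x /face[]//|x]; split=> [|[/face[_ xw] /xw//]].
  move: x; apply: cone_of_ind => [|x y [? x0] [? y0]|e x e0 [? x0]|z].
  - by split; [apply: cone_of0|apply: dot0r].
  - split; first exact: cone_ofD.
    by move: (dotDr u' x y); rewrite /dot x0 y0 addr0.
  - split; first exact: cone_ofZ.
    by move: (dotZr e u' x); rewrite /dot x0 mulr0.
  - by rewrite inE => /eqP ->; split=> //; apply: cone_of_mem.
pose y := \sum_i c i *: toQ t`_i.
have yt : cone_of t y by exists c.
have yE : y = dot l y *: toQ w.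
  apply/eqP; rewrite -subr_eq0; apply/eqP; rewrite -/(p y).
  have pD a b : p (a + b) = p a + p b.
    by rewrite /p dotDr scalerDl opprD addrACA.
  have pZ e a : p (e *: a) = e *: p a.
    by rewrite /p dotZr scalerBr scalerA.
  have p0 : p 0 = 0 by rewrite /p dot0r scale0r subr0.
  rewrite /y (big_morph p pD p0) -[RHS]ct.
  by apply: eq_bigr => i _; rewrite pZ.
case: (ltP 0 (dot l y)) => ly.
  case: (irr w ws); have -> : toQ w = (dot l y)^-1 *: y.
    by rewrite {2}yE scalerA mulVf ?scale1r // gt_eqF.
  by apply: cone_ofZ => //; rewrite invr_ge0 ltW.
have tj : t`_j \in s by apply: ts; apply: mem_nth.
have : c j *: toQ t`_j = 0.
  apply: sc; first by apply: cone_ofZ => //; apply: cone_of_mem.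
  have -> : - (c j *: toQ t`_j) =
      \sum_(i | i != j) c i *: toQ t`_i + (- dot l y) *: toQ w.
    have yj : y = c j *: toQ t`_j + \sum_(i | i != j) c i *: toQ t`_i.
      by rewrite /y (bigD1 j).
    by rewrite scaleNr -yE yj opprD addrCA subrr addr0.
  apply: cone_ofD; last by apply: cone_ofZ; [rewrite oppr_ge0|apply: cone_of_mem].
  elim/big_ind: _ => [|a b|i _]; [exact: cone_of0|exact: cone_ofD|].
  by apply: cone_ofZ => //; apply: cone_of_mem; apply: ts; apply: mem_nth.
by move/eqP; rewrite scaler_eq0 gt_eqF //= (negPf (nz _ tj)).
Qed.

Lemma pairingDl (m m' : 'rV[int]_d) w : pairing (m + m') w = pairing m w + pairing m' w.
Proof. by rewrite /pairing mulmxDl mxE. Qed.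
Lemma pairingZl (a : int) (m : 'rV[int]_d) w : pairing (a *: m) w = a * pairing m w.
Proof. by rewrite /pairing -scalemxAl mxE. Qed.

Lemma pairingZr (a : int) (m : 'rV[int]_d) w : pairing m (a *: w) = a * pairing m w.
Proof. by rewrite /pairing -scalemxAr mxE. Qed.

(** The factor [g] is the least positive value taken by [w] on the lattice. It divides every entry
    of [w], because a nonzero remainder would be a smaller positive value. *)
Lemma primitive_multiple w : w != 0 ->
  exists g w0, [/\ 0 < g, w = g *: w0 & exists m, pairing m w0 = 1].
Proof.
move=> w0; pose P n := `[< exists m, pairing m w = n.+1 >].
have exP : exists n, P n.
  have [i wi] : exists i, w i 0 != 0.
    apply/existsP; apply: contraNT w0; rewrite negb_exists => /forallP w0.
    apply/eqP/matrixP => i j; rewrite ord1 mxE; apply/eqP.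
    by have := w0 i; rewrite negbK.
  exists (absz (w i 0%R)).-1; apply/asboolP.
  exists (Num.sg (w i 0%R) *: delta_mx 0 i).
  rewrite pairingZl /pairing -rowE mxE prednK ?absz_gt0 //.
  by rewrite -normrEsg abszE.
case: (ex_minnP exP) => n /asboolP[m mw] n_min.
have dvd i : (n.+1%:Z %| w i 0%R)%Z.
  apply: contraT => ndvd.
  have [q wq] : exists q, pairing (delta_mx 0 i - q *: m) w = (w i 0%R %% n.+1)%Z.
    exists (w i 0%R %/ n.+1)%Z; rewrite -scaleNr pairingDl pairingZl mw.
    rewrite /pairing -rowE mxE {1}(divz_eq (w i 0%R) n.+1) mulNr addrC addKr //.
  have q0 : (w i 0%R %% n.+1)%Z != 0 by apply: contra ndvd => /eqP /dvdz_mod0P.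
  have qn : (w i 0%R %% n.+1)%Z < n.+1 by apply: ltz_pmod.
  case: (w i 0%R %% n.+1)%Z (modz_ge0 (w i 0%R) (isT : n.+1%:Z != 0)) q0 qn wq => // -[|z] // _ _ zn wq.
  have /n_min : P z by apply/asboolP; eexists; apply: wq.
  by move=> nz; move: zn; rewrite ltz_nat ltnS ltnNge nz.
exists n.+1%:Z, (\col_i (w i 0%R %/ n.+1)%Z); split=> //.
  by apply/matrixP => i j; rewrite ord1 !mxE mulrC divzK.
exists m; apply: (@mulfI _ n.+1%:Z) => //.
rewrite mulr1 -pairingZr -[RHS]mw; congr (pairing m _).
by apply/matrixP => i j; rewrite ord1 !mxE mulrC divzK.
Qed.

Definition nonneg_span r (v : 'I_r -> 'cV[int]_d) x : Prop :=
  exists2 c : 'I_r -> rat, (forall i, 0 <= c i) & x = \sum_i c i *: toQ (v i).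

(** The point lies in some cone of the fan. Each generator in an irredundant list for that cone
    spans a face, hence a cone of the fan, and is a positive multiple of a primitive vector, which
    is one of the [v i]. *)
Lemma fan_nonneg_span (Delta : set (set 'cV[rat]_d)) r (v : 'I_r -> 'cV[int]_d) :
    is_fan Delta -> is_complete Delta ->
    (forall w, is_ray Delta w <-> exists i, v i = w) ->
  forall x, nonneg_span v x.
Proof.
move=> fanD compD rays x; have [sigma Ds] := compD x.
have [sc [s0 s0E]] := fan_cone fanD Ds.
have [s sE irr] := irredundant_cone s0.
have {s0E sE} sE : sigma = cone_of s by rewrite sE.
rewrite sE in Ds sc *; move: x.
apply: cone_of_ind => [|x y [a a0 ->] [b b0 ->]|e x e0 [a a0 ->]|w ws].
- by exists (fun=> 0) => //; rewrite big1 // => i _; rewrite scale0r.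
- exists (fun i => a i + b i) => [i|]; first by rewrite addr_ge0.
  by rewrite -big_split /=; apply: eq_bigr => i _; rewrite scalerDl.
- exists (fun i => e * a i) => [i|]; first by rewrite mulr_ge0.
  by rewrite scaler_sumr; apply: eq_bigr => i _; rewrite scalerA.
have face := irredundant_face sc irr ws.
have Dw := fan_face fanD Ds face.
have w0 : w != 0.
  apply/eqP => w0; apply: (irr w ws).
  by rewrite w0 raddf0; apply: cone_of0.
have [g [w1 [g0 wE [m mw1]]]] := primitive_multiple w0.
have [j vj] : exists j, v j = w1.
  apply/rays; split=> [a|]; last by rewrite -(cone_of1Z w1 g0) -wE.
  by exists (a *: m); rewrite pairingZl mw1 mulr1.
exists (fun i => if i == j then g%:~R else 0) => [i|].
  by case: ifP => // _; rewrite ler0z ltW.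
rewrite (bigD1 j) //= eqxx big1 ?addr0 => [|i /negPf->]; last by rewrite scale0r.
by rewrite vj wE; apply/matrixP => a b; rewrite !mxE intrM.
Qed.

(* Expanding each [- v_i] as a nonnegative combination of the rays and adding up *)
(* the relations gives a relation [\sum_j c_j v_j = 0] with all [c_j >= 1].       *)
Lemma class_group_weight (Delta : set (set 'cV[rat]_d)) r (v : 'I_r -> 'cV[int]_d)
    (N : zmodType) (pi : {additive 'rV[int]_r -> N}) :
    is_fan Delta -> is_complete Delta ->
    (forall w, is_ray Delta w <-> exists i, v i = w) -> is_class_group v pi ->
  exists2 c : 'I_r -> rat, (forall i, 1 <= c i)
    & forall n, pi n = 0 -> \sum_i c i * (n 0 i)%:~R = 0.
Proof.
move=> fanD compD rays piE; have span := fan_nonneg_span fanD compD rays.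
have /choice[C CE] : forall i, exists c : 'I_r -> rat, (forall j, 0 <= c j) /\
    - toQ (v i) = \sum_j c j *: toQ (v j).
  by move=> i; have [c c0 cE] := span (- toQ (v i)); exists c.
exists (fun j => 1 + \sum_i C i j) => [j|n].
  by rewrite lerDl sumr_ge0 // => i _; apply: (CE i).1.
move/(class_group_exact piE) => [m ->].
have rel : \sum_j (1 + \sum_i C i j) *: toQ (v j) = 0.
  under eq_bigr do rewrite scalerDl scale1r scaler_suml.
  rewrite big_split exchange_big /=.
  under [X in _ + X]eq_bigr do rewrite -(CE _).2.
  by rewrite sumrN subrr.
(* Evaluating the relation among the rays on [m] gives the weighted sum of the entries of
   [rays_map v m]. *)
have /(congr1 (dot (map_mx intr m))) := rel; rewrite dot0r.
rewrite (big_morph _ (dotDr _) (dot0r _)) => relE; rewrite -[RHS]relE.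
by apply: eq_bigr => j _; rewrite dotZr mxE /pairing /dot -map_mxM [in RHS]mxE.
Qed.

End Cones.

(** * Nilpotent matrices *)

Section NilpotentMatrices.
Variables (k : closedFieldType) (n : nat).
Implicit Types (A : 'M[k]_n).

Definition mx_nilpotent A := exists m, A ^+ m = 0.

(** Every eigenvalue is 0 and the characteristic polynomial splits, so it equals ['X^n]; the trace
    is the opposite of its coefficient of degree [n.-1]. *)
Lemma mxtrace_nilpotent A : mx_nilpotent A -> \tr A = 0.
Proof.
move=> [m Am]; case: (posnP n) => [n0|n0].
  by rewrite /mxtrace big1 // => i; have := ltn_ord i; rewrite {2}n0.
have [s sE] := closed_field_poly_normal (char_poly A).
have s0 z : z \in s -> z = 0.
  move=> zs; have : root (char_poly A) z.
    rewrite sE (monicP (char_poly_monic A)) scale1r root_prod_XsubC //.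
  rewrite -eigenvalue_root_char => /eigenvalueP[v vA v0].
  have vAm l : v *m (A ^+ l) = z ^+ l *: v.
    elim: l => [|l IH]; first by rewrite !expr0 mulmx1 scale1r.
    by rewrite exprS [_ * _]/(_ *m _) mulmxA vA -scalemxAl IH scalerA -exprS.
  have := vAm m; rewrite Am mulmx0 => /esym/eqP.
  rewrite scaler_eq0 (negPf v0) orbF expf_eq0 => /andP[_ /eqP //].
have chE : char_poly A = 'X^n.
  have szs : size s = n.
    have := size_char_poly A; rewrite sE (monicP (char_poly_monic A)) scale1r.
    by rewrite size_prod_XsubC => -[].
  rewrite sE (monicP (char_poly_monic A)) scale1r -szs.
  rewrite big_seq (eq_bigr (fun=> 'X)) => [|z /s0 ->]; last by rewrite subr0.
  by rewrite -big_seq big_const_seq count_predT iter_mulr_1.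
have := char_poly_trace A n0; rewrite chE coefXn.
by rewrite ltn_eqF ?ltn_predL // => /esym/eqP; rewrite oppr_eq0 => /eqP.
Qed.

(* The trace of the product of a unipotent matrix with its conjugate by a        *)
(* transvection is [n - (A i j) ^+ 2], whereas a unipotent matrix has trace [n]. *)
Lemma transvection_conj_not_unipotent A i j :
    i != j -> A i j != 0 -> mx_nilpotent A ->
  ~ mx_nilpotent ((1 + A) * ((1 - delta_mx j i) * (1 + A) * (1 + delta_mx j i)) - 1).
Proof.
move=> ij Aij nA; set E := delta_mx j i => nil.
have EE : E * E = 0 by rewrite [LHS]mul_delta_mx_0.
have A2 : \tr (A * A) = 0.
  apply: mxtrace_nilpotent; have [m Am] := nA; exists m.
  by rewrite exprMn_comm // Am mul0r.
pose C := (1 - E) * A * (1 + E).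
have E1 : (1 - E) * (1 + E) = 1 by rewrite mulrDr mulr1 mulrBl mul1r EE subr0 subrK.
have E2 : (1 + E) * (1 - E) = 1 by rewrite mulrBr mulr1 mulrDl mul1r EE addr0 addrK.
(* The matrices [A], [C] and [A * A] have trace 0, and [E * A * E = A i j *: E], so this sum has
   trace [- (A i j) ^+ 2]. *)
have CE : (1 + A) * ((1 - E) * (1 + A) * (1 + E)) - 1 = A + C + A * C.
  have -> : (1 - E) * (1 + A) * (1 + E) = 1 + C.
    by rewrite [(1 - E) * (1 + A)]mulrDr mulr1 mulrDl E1.
  by rewrite mulrDl mul1r mulrDr mulr1 addrC -addrA addKr addrCA addrA.
have trM (B D : 'M[k]_n) : \tr (B * D) = \tr (D * B) by apply: mxtrace_mulC.
move: nil; rewrite {}CE => /mxtrace_nilpotent.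
rewrite !raddfD /= mxtrace_nilpotent // add0r.
have -> : \tr C = 0 by rewrite /C -mulrA trM -mulrA E2 mulr1 mxtrace_nilpotent.
have -> : A * C = A * A - A * E * A + (A * A * E - A * E * A * E).
  by rewrite /C !mulrA mulrBr mulr1 mulrBl mulrDr mulr1 mulrBl.
rewrite add0r !(raddfD, raddfN) /= A2 add0r.
rewrite (trM (A * E) A) mulrA addKr.
have mE (B D : 'M[k]_n) : B * D = B *m D by [].
have EE' : E = delta_mx j 0 *m (delta_mx 0 i : 'rV_n) by rewrite mul_delta_mx.
have iAj : (delta_mx 0 i : 'rV_n) *m A *m delta_mx j 0 = (A i j)%:M :> 'M_1.
  by apply/matrixP => a b; rewrite !ord1 -colE mxE -rowE !mxE mulr1n.
have EAE : E * A * E = A i j *: E.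
  have -> : E * A * E = delta_mx j 0 *m ((delta_mx 0 i : 'rV_n) *m A *m delta_mx j 0)
      *m (delta_mx 0 i : 'rV_n) by rewrite !mE EE' !mulmxA.
  by rewrite iAj mul_mx_scalar -scalemxAl -EE'.
have AE : \tr (A * E) = A i j.
  by rewrite mE EE' mulmxA mxtrace_mulC mulmxA iAj mxtrace_scalar.
rewrite -!mulrA [E * (A * E)]mulrA EAE mE -scalemxAr -mE linearZ /= AE.
by move/eqP; rewrite oppr_eq0 mulf_eq0 orbb (negPf Aij).
Qed.

Lemma nilpotent_diag_eq0 A :
  (forall i j, i != j -> A i j = 0) -> mx_nilpotent A -> A = 0.
Proof.
move=> Ad [m Am]; apply/matrixP => i j; rewrite mxE.
have [<-{j}|/Ad//] := eqVneq i j.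
have Aii l : (A ^+ l) i i = A i i ^+ l.
  elim: l => [|l IH]; first by rewrite !expr0 mxE eqxx.
  rewrite exprS mxE (bigD1 i) //= IH -exprS big1 ?addr0 // => j ji.
  by rewrite Ad ?mul0r // eq_sym.
have /eqP := Aii m; rewrite Am mxE eq_sym expf_eq0 => /andP[_ /eqP //].
Qed.

End NilpotentMatrices.

(** * Polynomials: order and homogeneity *)

Section Order.
Variables (k : fieldType) (r : nat).
Implicit Types (p q : {mpoly k[r]}) (n : nat) (m : 'X_{1..r}).

(** Membership in the [n]-th power of the ideal generated by the variables. *)
Definition ordge n p := forall m, (mdeg m < n)%N -> p@_m = 0.

Lemma ordge_zero n : ordge n 0.
Proof. by move=> m _; rewrite mcoeff0. Qed.

Lemma ordgeD n p q : ordge n p -> ordge n q -> ordge n (p + q).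
Proof. by move=> op oq m mn; rewrite mcoeffD op ?oq ?addr0. Qed.

Lemma ordgeZ n c p : ordge n p -> ordge n (c *: p).
Proof. by move=> op m mn; rewrite mcoeffZ op ?mulr0. Qed.

Lemma ordge_sum n (I : Type) (s : seq I) (P : pred I) (F : I -> {mpoly k[r]}) :
  (forall i, P i -> ordge n (F i)) -> ordge n (\sum_(i <- s | P i) F i).
Proof. by move=> oF; elim/big_ind: _ => //; [apply: ordge_zero|apply: ordgeD]. Qed.

Lemma ordge_leq n n' p : (n <= n')%N -> ordge n' p -> ordge n p.
Proof. by move=> nn op m mn; apply: op; apply: leq_trans nn. Qed.

Lemma ordge0 p : ordge 0 p.
Proof. by []. Qed.

Lemma ordgeM a b p q : ordge a p -> ordge b q -> ordge (a + b) (p * q).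
Proof.
move=> op oq m mab; rewrite mcoeffM big1 // => -[m1 m2] /= /eqP mE.
case: (ltnP (mdeg m1) a) => [/op -> | m1a]; first by rewrite mul0r.
rewrite (oq m2) ?mulr0 // -(ltn_add2l a); apply: leq_ltn_trans mab.
by apply: leq_trans (eq_leq (esym (congr1 (@mdeg r) mE))); rewrite mdegD leq_add2r.
Qed.

Lemma ordgeX m : ordge (mdeg m) ('X_[m] : {mpoly k[r]}).
Proof. by move=> m' mm; rewrite mcoeffX; case: eqP mm => // ->; rewrite ltnn. Qed.

Lemma ordgeP n p : ordge n p <-> forall m, m \in msupp p -> (n <= mdeg m)%N.
Proof.
split=> op m; last by rewrite ltnNge => /negP mn; apply: memN_msupp_eq0; apply/negP => /op.
by rewrite mcoeff_msupp leqNgt; apply: contra => /op ->.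
Qed.

Definition var_ordge1 (f : {mpoly k[r]} -> {mpoly k[r]}) :=
  forall i, ordge 1 (f 'X_i).

(** The image of ['X_i] is read in column [i], so that composition of morphisms corresponds to the
    matrix product in the same order. *)
Definition linpart (f : {mpoly k[r]} -> {mpoly k[r]}) : 'M[k]_r :=
  \matrix_(j, i) (f 'X_i)@_U_(j).

Lemma linpartE f i : var_ordge1 f ->
  ordge 2 (f 'X_i - \sum_j linpart f j i *: 'X_j).
Proof.
move=> f1 m; rewrite ltnS leq_eqVlt ltnS leqn0 mcoeffB linear_sum /=.
case/orP => [/mdeg1P[j /eqP ->]|m0].
  rewrite (bigD1 j) //= mcoeffZ mcoeffXU eqxx mulr1 mxE big1 ?addr0 ?subrr //.
  by move=> l /negPf lj; rewrite mcoeffZ mcoeffXU lj mulr0.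
rewrite f1 ?(eqP m0) // big1 ?subr0 // => l _.
rewrite mcoeffZ mcoeffX; case: eqP => [lm|]; last by rewrite mulr0.
by move: m0; rewrite -lm mdeg1.
Qed.

Variable f : {lrmorphism {mpoly k[r]} -> {mpoly k[r]}}.
Hypothesis f1 : var_ordge1 f.

Lemma ordge_morph_X m : ordge (mdeg m) (f 'X_[m]).
Proof.
rewrite mpolyXE_id rmorph_prod mdegE /=.
elim/big_rec2: _ => [|i p n _ op]; first exact: ordge0.
apply: ordgeM => //; rewrite rmorphXn; elim: (m i) => [|l IH]; first exact: ordge0.
by rewrite exprS -add1n; apply: ordgeM => //; apply: f1.
Qed.

Lemma ordge_morph n p : ordge n p -> ordge n (f p).
Proof.
move=> /ordgeP op; rewrite [p]mpolyE linear_sum big_seq /=.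
apply: ordge_sum => m /op mn; rewrite linearZ; apply: ordgeZ.
exact: (ordge_leq mn (@ordge_morph_X m)).
Qed.

(** Since [f] preserves order at least 2, the nonlinear terms of [g 'X_i] do not contribute to the
    linear part of the composite. *)
Lemma linpart_comp (g : {mpoly k[r]} -> {mpoly k[r]}) : var_ordge1 g ->
  linpart (f \o g) = linpart f *m linpart g.
Proof.
move=> g1; apply/matrixP => j i; rewrite !mxE /=.
have /ordge_morph/(_ U_(j)%MM) := linpartE i g1.
rewrite mdeg1 => /(_ isT); rewrite raddfB mcoeffB /= => /eqP.
rewrite subr_eq0 => /eqP ->; rewrite !linear_sum /=; apply: eq_bigr => l _.
by rewrite linearZ mcoeffZ mulrC !mxE.
Qed.

Lemma linpart_id : linpart idfun = 1%:M.
Proof. by apply/matrixP => j i; rewrite !mxE /= mcoeffXU eq_sym. Qed.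

Hypothesis f_lin1 : linpart f = 1%:M.

(** A morphism trivial on m/m^2 is trivial on every m^n/m^(n+1). The property passes to products
    because f(pq) - pq = (f(p) - p) f(q) + p (f(q) - q). *)
Lemma ordge_morph_sub n p : ordge n p -> ordge n.+1 (f p - p).
Proof.
pose Q n p := ordge n p /\ ordge n.+1 (f p - p).
have QM a b p1 q1 : Q a p1 -> Q b q1 -> Q (a + b)%N (p1 * q1).
  move=> [op1 op2] [oq1 oq2]; split; first exact: ordgeM.
  have -> : f (p1 * q1) - p1 * q1 = (f p1 - p1) * f q1 + p1 * (f q1 - q1).
    by rewrite rmorphM mulrBl mulrBr addrA subrK.
  apply: ordgeD; first by rewrite -addSn; apply: ordgeM => //; apply: ordge_morph.
  by rewrite -addnS; apply: ordgeM.
have Q1 : Q 0%N 1 by split; [apply: ordge0|rewrite rmorph1 subrr; apply: ordge_zero].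
have QX i : Q 1%N 'X_i.
  split; first by have := @ordgeX U_(i)%MM; rewrite mdeg1.
  have := linpartE i f1; rewrite f_lin1 (bigD1 i) //= mxE eqxx scale1r big1 ?addr0 //.
  by move=> j /negPf ji; rewrite mxE ji scale0r.
have QXm m : Q (mdeg m) 'X_[m].
  rewrite mpolyXE_id mdegE; elim/big_rec2: _ => // i p0 n0 _ Qp; apply: (QM) => //.
  by elim: (m i) => // l IH; rewrite exprS -add1n; apply: QM.
move=> /ordgeP op.
have -> : f p - p = \sum_(m <- msupp p) p@_m *: (f 'X_[m] - 'X_[m]).
  transitivity (f (\sum_(m <- msupp p) p@_m *: 'X_[m]) - \sum_(m <- msupp p) p@_m *: 'X_[m]).
    by rewrite -mpolyE.
  by rewrite linear_sum -sumrB; apply: eq_bigr => m _; rewrite linearZ scalerBr.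
rewrite big_seq; apply: ordge_sum => m /op mn; apply: ordgeZ.
exact: (ordge_leq (mn : n.+1 <= (mdeg m).+1)%N (QXm m).2).
Qed.

End Order.

Section Homogeneous.
Variables (k : fieldType) (r : nat) (N : zmodType) (pi : {additive 'rV[int]_r -> N}).
Implicit Types (p q : {mpoly k[r]}) (m : 'X_{1..r}).

Local Notation degN := (degN pi).
Local Notation homogeneous := (@homogeneous k r N pi).

Lemma degND m m' : degN (m + m')%MM = degN m + degN m'.
Proof.
by rewrite /degN -raddfD; congr (pi _); apply/rowP => i; rewrite !mxE mnmDE PoszD.
Qed.

Lemma degN0 : degN 0%MM = 0.
Proof.
by rewrite /degN -[RHS](raddf0 pi); congr (pi _); apply/rowP => i; rewrite !mxE mnm0E.
Qed.

Lemma homogeneousP a p : homogeneous a p <-> forall m, degN m != a -> p@_m = 0.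
Proof.
split=> hp m => [ma|]; last by rewrite mcoeff_msupp; apply: contraNeq => /hp ->.
by apply: memN_msupp_eq0; apply: contra ma => /hp ->.
Qed.

Lemma homogeneousX m : homogeneous (degN m) 'X_[m].
Proof. by move=> m'; rewrite msuppX inE => /eqP ->. Qed.

Lemma homogeneous0 a : homogeneous a 0.
Proof. by apply/homogeneousP => m _; rewrite mcoeff0. Qed.

Lemma homogeneousD a p q : homogeneous a p -> homogeneous a q -> homogeneous a (p + q).
Proof.
move=> /homogeneousP hp /homogeneousP hq; apply/homogeneousP => m ma.
by rewrite mcoeffD hp ?hq ?addr0.
Qed.

Lemma homogeneousZ a c p : homogeneous a p -> homogeneous a (c *: p).
Proof. by move=> /homogeneousP hp; apply/homogeneousP => m ma; rewrite mcoeffZ hp ?mulr0. Qed.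

Lemma homogeneousB a p q : homogeneous a p -> homogeneous a q -> homogeneous a (p - q).
Proof. by move=> hp hq; rewrite -scaleN1r; apply/homogeneousD/homogeneousZ. Qed.

Lemma homogeneous_sum a (I : Type) (s : seq I) (P : pred I) (F : I -> {mpoly k[r]}) :
  (forall i, P i -> homogeneous a (F i)) -> homogeneous a (\sum_(i <- s | P i) F i).
Proof. by move=> hF; elim/big_ind: _ => //; [apply: homogeneous0|apply: homogeneousD]. Qed.

Lemma homogeneousM a b p q : homogeneous a p -> homogeneous b q -> homogeneous (a + b) (p * q).
Proof.
move=> hp hq m /msuppM_le/allpairsP[[m1 m2] [/hp <- /hq <- ->]].
exact: degND.
Qed.

Lemma homogeneous_morph (f : {lrmorphism {mpoly k[r]} -> {mpoly k[r]}}) a p :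
    (forall i, homogeneous (degN U_(i)) (f 'X_i)) ->
  homogeneous a p -> homogeneous a (f p).
Proof.
move=> fX hp; rewrite [p]mpolyE linear_sum big_seq /=.
apply: homogeneous_sum => m /hp <-; rewrite linearZ; apply: homogeneousZ.
rewrite mpolyXE_id rmorph_prod [X in degN X]multinomUE_id /=.
elim/big_rec2: _ => [|i p0 m0 _ hp0].
  by rewrite -mpolyX0; apply: homogeneousX.
rewrite degND; apply: homogeneousM => //; rewrite rmorphXn; elim: (m i) => [|l IH].
  by rewrite mulm0n expr0 -mpolyX0; apply: homogeneousX.
by rewrite exprS mulmS degND; apply: homogeneousM.
Qed.

Lemma lrmorphism_eq_var (f g : {lrmorphism {mpoly k[r]} -> {mpoly k[r]}}) :
  (forall i, f 'X_i = g 'X_i) -> f =1 g.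
Proof.
move=> fg p; rewrite [p]mpolyE !linear_sum; apply: eq_bigr => m _ /=.
rewrite !linearZ mpolyXE_id !rmorph_prod; congr (_ *: _).
by apply: eq_bigr => i _; rewrite !rmorphXn /= fg.
Qed.

End Homogeneous.

(** * Regular functions *)

Section LocallyNilpotent.
Variables (k : fieldType) (G : funGroup k) (g : G).
Implicit Types f h : G -> k.

Definition right_diff f : G -> k := fun x => f (x * g)%g - f x.
Definition locnil f := exists n, iter n right_diff f = (fun=> 0).

Lemma iter_right_diff0 n : iter n right_diff (fun=> 0) = (fun=> 0).
Proof. by elim: n => // n IH; rewrite iterSr -[RHS]IH; congr iter; apply/funext => x; rewrite /right_diff subrr. Qed.

Lemma iter_right_diffD n f h :
  iter n right_diff (f \+ h) = iter n right_diff f \+ iter n right_diff h.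
Proof.
elim: n f h => // n IH f h; rewrite !iterSr -IH; congr iter.
by apply/funext => x; rewrite /right_diff /= opprD addrACA.
Qed.

Lemma locnil_cst c : locnil (fun=> c).
Proof. by exists 1%N; apply/funext => x; rewrite /= /right_diff subrr. Qed.

Lemma locnilD f h : locnil f -> locnil h -> locnil (f \+ h).
Proof.
move=> [a fa] [b hb]; exists (a + b)%N; rewrite iter_right_diffD.
rewrite {1}addnC !iterD fa hb !iter_right_diff0.
by apply/funext => x; rewrite /= addr0.
Qed.

Lemma right_diffM f h : right_diff (f \* h) =
  (right_diff f \* h) \+ ((f \* right_diff h) \+ (right_diff f \* right_diff h)).
Proof.
apply/funext => x; rewrite /right_diff /=.
set a := f (x * g)%g; set b := h (x * g)%g.
by rewrite -mulrDl [f x + _]addrC subrK mulrBl mulrBr [RHS]addrC addrA subrK.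
Qed.

(** In each of the three terms of the Leibniz rule [right_diffM] the sum of the two nilpotency
    exponents has dropped. Thus unipotence can be tested on generators of the coordinate ring. *)
Lemma locnilM f h : locnil f -> locnil h -> locnil (f \* h).
Proof.
move=> [a fa] [b hb]; have [s] := ubnP (a + b)%N.
elim: s a b f h fa hb => // s IH [|a] [|b] f h fa hb ab.
- by exists 0%N; apply/funext => x; rewrite /= (fa : f = _) mul0r.
- by exists 0%N; apply/funext => x; rewrite /= (fa : f = _) mul0r.
- by exists 0%N; apply/funext => x; rewrite /= (hb : h = _) mulr0.
rewrite iterSr in fa; rewrite iterSr in hb.
suff [n dn] : locnil (right_diff (f \* h)) by exists n.+1; rewrite iterSr.
rewrite right_diffM; apply: locnilD; last apply: locnilD.
- by apply: (IH a b.+1) => //; rewrite ?iterSr // -ltnS -addSn.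
- by apply: (IH a.+1 b) => //; rewrite ?iterSr // -ltnS -addnS.
- by apply: (IH a b) => //; rewrite -ltnS; apply: leq_trans ab; rewrite ltnS addSn ltnS leq_add2l.
Qed.

Lemma locnil_genAlg (S : set (G -> k)) : (forall f, S f -> locnil f) ->
  forall f, genAlg S f -> locnil f.
Proof.
move=> LS f; elim=> {f} [f|c|f h _ IHf _ IHh|f h _ IHf _ IHh].
- exact: LS.
- exact: locnil_cst.
- exact: locnilD.
- exact: locnilM.
Qed.

End LocallyNilpotent.

(** * Connectedness by rational curves *)

Section RationalPaths.
Variable k : closedFieldType.
Implicit Types (D P Q : {poly k}) (h : k -> k).

Definition rational_on D h := exists P Q, forall t, D.[t] != 0 ->
  Q.[t] != 0 /\ h t = P.[t] / Q.[t].

Lemma rational_on_poly D P : rational_on D (horner P).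
Proof. by exists P, 1 => t _; rewrite hornerC oner_neq0 divr1. Qed.

Lemma rational_on_ext D h h' : (forall t, D.[t] != 0 -> h t = h' t) ->
  rational_on D h -> rational_on D h'.
Proof.
by move=> hh [P [Q PQ]]; exists P, Q => t Dt; rewrite -hh //; apply: PQ.
Qed.

Lemma rational_on_genAlg (S : set (k -> k)) D :
  (forall h, S h -> rational_on D h) -> forall h, genAlg S h -> rational_on D h.
Proof.
move=> SD h; elim=> {h} [h|c|f h _ [P [Q PQ]] _ [P' [Q' PQ']]|f h _ [P [Q PQ]] _ [P' [Q' PQ']]].
- exact: SD.
- by exists c%:P, 1 => t _; rewrite !hornerC oner_neq0 divr1.
- exists (P * Q' + P' * Q), (Q * Q') => t Dt.
  have [Q0 /= ->] := PQ t Dt; have [Q'0 ->] := PQ' t Dt.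
  by rewrite hornerD !hornerM mulf_neq0 // addf_div.
- exists (P * P'), (Q * Q') => t Dt.
  have [Q0 /= ->] := PQ t Dt; have [Q'0 ->] := PQ' t Dt.
  by rewrite !hornerM mulf_neq0 // mulf_div.
Qed.

(** An open subset of the affine line is irreducible: two nonempty relatively open subsets of the
    curve contain the points where two nonzero polynomials do not vanish, hence they meet. *)
Lemma connected_rational_path (G : funGroup k) D (gamma : k -> zariski G) :
    (forall f : G -> k, regular f -> rational_on D (fun t => f (gamma t))) ->
  connected (gamma @` [set t | D.[t] != 0])%classic.
Proof.
move=> rat_gamma B [b Bb] [C oC BC] [E cE BE].
apply/seteqP; split=> [x|x Ax]; first by rewrite {1}BC => -[].
case: (pselect (B x)) => // nBx; exfalso.
have [t Dt tb] : (gamma @` [set t | D.[t] != 0])%classic b.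
  by have : B b by []; rewrite {1}BC => -[].
have [t' Dt' tx] := Ax.
have Cb : C b by have : B b by []; rewrite {1}BC => -[].
have nEx : (~` E)%classic x by move=> Ex; apply: nBx; rewrite BE.
have onE : open (~` E)%classic by apply: closed_openC.
move: oC onE; rewrite !zariski_openE => -[S rS CS] [S' rS' ES'].
have [f Sf fb] := (CS b).1 Cb; have [f' Sf' fx] := (ES' x).1 nEx.
have [P [Q PQ]] := rat_gamma f (rS _ Sf).
have [P' [Q' PQ']] := rat_gamma f' (rS' _ Sf').
have nz (F : {poly k}) u : F.[u] != 0 -> F != 0.
  by apply: contraNneq => ->; rewrite horner0.
have P0 : P != 0.
  apply: (nz _ t); move: fb; rewrite -tb (PQ t Dt).2.
  by rewrite mulf_eq0 negb_or => /andP[].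
have P'0 : P' != 0.
  apply: (nz _ t'); move: fx; rewrite -tx (PQ' t' Dt').2.
  by rewrite mulf_eq0 negb_or => /andP[].
have [u] : exists u, ~~ root (D * (P * P')) u.
  by apply/closed_nonrootP; rewrite !mulf_neq0 //; apply: nz Dt.
rewrite /root !hornerM !mulf_eq0 !negb_or => /and3P[Du Pu P'u].
have Au : (gamma @` [set t | D.[t] != 0])%classic (gamma u) by exists u.
have Cu : C (gamma u).
  by apply/CS; exists f => //; rewrite (PQ u Du).2 mulf_neq0 // invr_eq0 (PQ u Du).1.
have : B (gamma u) by rewrite BC.
rewrite BE => -[_].
have : (~` E)%classic (gamma u).
  by apply/ES'; exists f' => //; rewrite (PQ' u Du).2 mulf_neq0 // invr_eq0 (PQ' u Du).1.
by [].
Qed.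

End RationalPaths.

Section PolynomialFamilies.
Variables (k : fieldType) (r : nat) (T : Type) (S : set (T -> k)).
Implicit Types (P : T -> {mpoly k[r]}).

(* Finite sums [\sum_a f_a(t) q_a]: the elements of the tensor product of the *)
(* algebra generated by [S] with the polynomial ring.                         *)
Inductive polyFamily : (T -> {mpoly k[r]}) -> Prop :=
| FamScale f q of genAlg S f : polyFamily (fun t => f t *: q)
| FamAdd P P' of polyFamily P & polyFamily P' : polyFamily (fun t => P t + P' t).

Lemma polyFamily_cst q : polyFamily (fun=> q).
Proof.
have -> : (fun=> q) = (fun _ : T => 1 *: q) by apply/funext => t; rewrite scale1r.
by apply: (@FamScale (fun=> 1)); apply: GenCst.
Qed.

Lemma polyFamilyM P P' : polyFamily P -> polyFamily P' -> polyFamily (fun t => P t * P' t).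
Proof.
elim=> {P} [f q rf|P1 P2 _ IH1 _ IH2] FP'; last first.
  have -> : (fun t => (P1 t + P2 t) * P' t) = (fun t => P1 t * P' t + P2 t * P' t).
    by apply/funext => t; rewrite mulrDl.
  exact: FamAdd (IH1 FP') (IH2 FP').
elim: FP' => {P'} [f' q' rf'|P1 P2 _ IH1 _ IH2]; last first.
  have -> : (fun t => f t *: q * (P1 t + P2 t)) =
            (fun t => f t *: q * P1 t + f t *: q * P2 t).
    by apply/funext => t; rewrite mulrDr.
  exact: FamAdd IH1 IH2.
have -> : (fun t => f t *: q * (f' t *: q')) = (fun t => (f \* f') t *: (q * q')).
  by apply/funext => t; rewrite -scalerAl -scalerAr scalerA.
exact/FamScale/GenMul.
Qed.

Lemma polyFamily_sum (I : Type) (s : seq I) (F : I -> T -> {mpoly k[r]}) :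
  (forall i, polyFamily (F i)) -> polyFamily (fun t => \sum_(i <- s) F i t).
Proof.
move=> HF; elim: s => [|i s IH].
  have -> : (fun t => \sum_(i <- [::]) F i t) = (fun=> 0).
    by apply/funext => t; rewrite big_nil.
  exact: polyFamily_cst.
have -> : (fun t => \sum_(j <- i :: s) F j t) = (fun t => F i t + \sum_(j <- s) F j t).
  by apply/funext => t; rewrite big_cons.
exact: FamAdd.
Qed.

Lemma polyFamily_prod (I : Type) (s : seq I) (F : I -> T -> {mpoly k[r]}) :
  (forall i, polyFamily (F i)) -> polyFamily (fun t => \prod_(i <- s) F i t).
Proof.
move=> HF; elim: s => [|i s IH].
  have -> : (fun t => \prod_(i <- [::]) F i t) = (fun=> 1).
    by apply/funext => t; rewrite big_nil.
  exact: polyFamily_cst.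
have -> : (fun t => \prod_(j <- i :: s) F j t) = (fun t => F i t * \prod_(j <- s) F j t).
  by apply/funext => t; rewrite big_cons.
exact: polyFamilyM.
Qed.

Lemma polyFamilyX P n : polyFamily P -> polyFamily (fun t => P t ^+ n).
Proof.
move=> FP; elim: n => [|n IH]; first exact: polyFamily_cst.
have -> : (fun t => P t ^+ n.+1) = (fun t => P t * P t ^+ n).
  by apply/funext => t; rewrite exprS.
exact: polyFamilyM.
Qed.

Lemma genAlg_polyFamily P (l : {scalar {mpoly k[r]}}) :
  polyFamily P -> genAlg S (fun t => l (P t)).
Proof.
elim=> {P} [f q rf|P1 P2 _ IH1 _ IH2].
  have -> : (fun t => l (f t *: q)) = f \* (fun=> l q).
    by apply/funext => t; rewrite linearZ.
  by apply: GenMul => //; apply: GenCst.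
have -> : (fun t => l (P1 t + P2 t)) = (fun t => l (P1 t)) \+ (fun t => l (P2 t)).
  by apply/funext => t; rewrite linearD.
exact: GenAdd.
Qed.

Lemma polyFamily_morph (g : T -> {lrmorphism {mpoly k[r]} -> {mpoly k[r]}}) p :
    (forall i, polyFamily (fun t => g t 'X_i)) -> polyFamily (fun t => g t p).
Proof.
move=> gX.
have -> : (fun t => g t p) =
    (fun t => \sum_(m <- msupp p) p@_m *: \prod_(i < r) g t 'X_i ^+ m i).
  apply/funext => t; rewrite {1}[p]mpolyE linear_sum; apply: eq_bigr => m _.
  rewrite /= linearZ mpolyXE_id rmorph_prod; congr (_ *: _).
  by apply: eq_bigr => i _; rewrite rmorphXn.
apply: polyFamily_sum => m.
have -> : (fun t => p@_m *: \prod_(i < r) g t 'X_i ^+ m i) =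
    (fun t => p@_m *: 1 * \prod_(i < r) g t 'X_i ^+ m i).
  by apply/funext => t; rewrite -scalerAl mul1r.
apply: polyFamilyM; first exact: polyFamily_cst.
by apply: polyFamily_prod => i; apply: polyFamilyX.
Qed.

(** A family of automorphisms is algebraic as soon as the images of the variables are, both under
    the automorphisms and under their inverses. *)
Lemma gaut_regular_family (N : zmodType) (pi : {additive 'rV[int]_r -> N})
    (gamma : T -> gaut k pi) :
    (forall i, polyFamily (fun t => gamma t 'X_i)) ->
    (forall i, polyFamily (fun t => gaut_inv (gamma t) 'X_i)) ->
  forall F, gaut_regular F -> genAlg S (fun t => F (gamma t)).
Proof.
move=> gX gVX; apply: genAlg_comp => _ [p [l [->|->]]].
  by apply: genAlg_polyFamily; apply: (polyFamily_morph (g := fun t => gamma t)).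
by apply: genAlg_polyFamily; apply: (polyFamily_morph (g := fun t => gaut_inv (gamma t))).
Qed.

End PolynomialFamilies.

(** * Graded automorphisms and their linear parts *)

Section GradedAutomorphisms.
Variables (k : fieldType) (r : nat) (N : zmodType) (pi : {additive 'rV[int]_r -> N}).
Local Notation degN := (degN pi).
Local Notation gaut := (gaut k pi).
Local Notation homogeneous := (@homogeneous k r N pi).
Implicit Types (f g u : gaut) (A B : 'M[k]_r).

Hypothesis deg0 : forall m, degN m = 0 -> m = 0%MM.

(** A constant term in [f 'X_i] would force the variable to have degree 0, which [deg0] excludes. *)
Lemma gaut_var_ordge1 f : var_ordge1 f.
Proof.
move=> i m; rewrite ltnS leqn0 mdeg_eq0 => /eqP ->.
have /homogeneousP-> // := @gaut_graded _ _ _ _ f _ _ (@homogeneousX k _ _ pi U_(i)%MM).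
rewrite degN0; apply/eqP => /esym /deg0 /eqP.
by rewrite mnm1_eq0.
Qed.

Lemma linpart_gautM f g : linpart (f * g)%g = linpart f *m linpart g.
Proof. by apply: linpart_comp; apply: gaut_var_ordge1. Qed.

Lemma linpart_gautV f : linpart (f^-1)%g *m linpart f = 1%:M.
Proof. by rewrite -linpart_gautM mulVg; apply: linpart_id. Qed.

Lemma linpart_gautVr f : linpart f *m linpart (f^-1)%g = 1%:M.
Proof. by rewrite -linpart_gautM mulgV; apply: linpart_id. Qed.

Definition graded_mx A := forall i j, degN U_(i) != degN U_(j) -> A i j = 0.

Lemma linpart_graded f : graded_mx (linpart f).
Proof.
move=> j i ji; rewrite mxE.
by have /homogeneousP-> := @gaut_graded _ _ _ _ f _ _ (@homogeneousX k _ _ pi U_(i)%MM).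
Qed.

Definition lin_sub A : {mpoly k[r]} -> {mpoly k[r]} :=
  comp_mpoly [tuple \sum_j A j i *: 'X_j | i < r].
HB.instance Definition _ A := GRing.LRMorphism.on (lin_sub A).

Lemma lin_subX A i : lin_sub A 'X_i = \sum_j A j i *: 'X_j.
Proof. by rewrite /lin_sub comp_mpolyXU -tnth_nth tnth_mktuple. Qed.

Lemma lin_subK A B : A *m B = 1%:M -> cancel (lin_sub B) (lin_sub A).
Proof.
move=> AB; apply: (@lrmorphism_eq_var _ _ (lin_sub A \o lin_sub B) idfun) => i /=.
rewrite lin_subX linear_sum /=.
under eq_bigr do rewrite linearZ /= lin_subX scaler_sumr.
rewrite exchange_big /= (bigD1 i) //= [X in _ + X]big1 => [|j /negPf ji].
  rewrite addr0 -[RHS]scale1r; under eq_bigr do rewrite scalerA mulrC.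
  have := congr1 (fun M : 'M_r => M i i) AB; rewrite !mxE eqxx mulr1n => <-.
  by rewrite scaler_suml.
under eq_bigr do rewrite scalerA mulrC.
have := congr1 (fun M : 'M_r => M j i) AB; rewrite !mxE ji => E.
by rewrite -scaler_suml E scale0r.
Qed.

Lemma lin_sub_graded A : graded_mx A ->
  forall a p, homogeneous a p -> homogeneous a (lin_sub A p).
Proof.
move=> gA a p; apply: homogeneous_morph => i /=; rewrite lin_subX.
apply: homogeneous_sum => j _; have [ij|/gA ->] := eqVneq (degN U_(j)) (degN U_(i)).
  by rewrite -ij; apply/homogeneousZ/homogeneousX.
by rewrite scale0r; apply: homogeneous0.
Qed.

Definition lin_gaut A B (AB : A *m B = 1%:M) (BA : B *m A = 1%:M)
    (gA : graded_mx A) (gB : graded_mx B) : gaut :=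
  @GAut k r N pi (lin_sub A) (lin_sub B) (lin_subK BA) (lin_subK AB)
    (lin_sub_graded gA) (lin_sub_graded gB).

Lemma linpart_lin_sub A : linpart (lin_sub A) = A.
Proof.
apply/matrixP => j i; rewrite mxE lin_subX linear_sum (bigD1 j) //=.
rewrite mcoeffZ mcoeffXU eqxx mulr1 big1 ?addr0 // => l /negPf lj.
by rewrite mcoeffZ mcoeffXU lj mulr0.
Qed.

Section Unipotent.
Hypothesis deg_bound : forall a, exists b, forall m, degN m = a -> (mdeg m < b)%N.

(** Each application of u - 1 stays in the graded piece and raises the order, while total degree is
    bounded there. The exponent depends on [a] alone, which [linpart1_locnil] needs for matrix
    coefficients of inverses. *)
Lemma iter_gaut_sub_eq0 a : exists n, forall u p, linpart u = 1%:M ->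
  homogeneous a p -> iter n (fun q => u q - q) p = 0.
Proof.
have [n n_bound] := deg_bound a; exists n => u p u1 hp.
have [hn on] : homogeneous a (iter n (fun q => u q - q) p) /\
    ordge n (iter n (fun q => u q - q) p).
  elim: (n) => [|l [hl ol]]; first by split=> //; apply: ordge0.
  split; last by apply: ordge_morph_sub => //; apply: gaut_var_ordge1.
  by apply: homogeneousB => //; apply: gaut_graded.
apply/mpolyP => m; rewrite mcoeff0; have [/n_bound/on//|] := eqVneq (degN m) a.
by move: m; apply/homogeneousP.
Qed.

Lemma linpart1_locnil (u : Autg k pi) (F : Autg k pi -> k) :
  linpart (u : gaut) = 1%:M -> gaut_regular F -> locnil u F.
Proof.
move=> u1; apply: (@locnil_genAlg _ (Autg k pi) u (@gaut_gens k r N pi)).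
move=> {}F [p [l lE]].
have uV1 : linpart (u^-1)%g = 1%:M :> 'M[k]_r.
  by rewrite -[LHS]mulmx1 -u1 linpart_gautV.
case: lE => ->{F}; elim/mpolyind: p => [|c m p _ _ IH].
- have -> : (fun f : Autg k pi => l ((f : gaut) 0)) = (fun=> 0).
    by apply/funext => f; rewrite !linear0.
  exact: locnil_cst.
- have -> : (fun f : Autg k pi => l ((f : gaut) (c *: 'X_[m] + p))) =
     ((fun=> c) \* (fun f => l ((f : gaut) 'X_[m]))) \+ (fun f => l ((f : gaut) p)).
    by apply/funext => f; rewrite /= linearP linearP.
  apply: locnilD => //; apply: locnilM; first exact: locnil_cst.
  (* Translation by [u] acts here on the argument: the difference of l(f q) is l(f (u q - q)). *)
  have [n /(_ u 'X_[m] u1 (@homogeneousX _ _ _ _ m)) n0] := iter_gaut_sub_eq0 (degN m).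
  exists n; suff iterE q : iter n (right_diff u) (fun f => l ((f : gaut) q)) =
      (fun f => l ((f : gaut) (iter n (fun q => (u : gaut) q - q) q))).
    by rewrite iterE n0; apply/funext => f; rewrite !linear0.
  elim: (n) q => // j IHj q; rewrite !iterSr -IHj; congr iter.
  by apply/funext => f; rewrite /right_diff !linearB.
- have -> : (fun f : Autg k pi => l (gaut_inv f 0)) = (fun=> 0).
    by apply/funext => f; rewrite !linear0.
  exact: locnil_cst.
- have -> : (fun f : Autg k pi => l (gaut_inv f (c *: 'X_[m] + p))) =
     ((fun=> c) \* (fun f => l (gaut_inv f 'X_[m]))) \+ (fun f => l (gaut_inv f p)).
    by apply/funext => f; rewrite /= linearP linearP.
  apply: locnilD => //; apply: locnilM; first exact: locnil_cst.
  (* For inverses the difference acts on the other side: l is replaced by its composite with u^-1 -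
     1, applied to the image of ['X_[m]] under [gaut_inv f]. That polynomial varies with [f] but
     stays homogeneous of degree [degN m]. *)
  have [n n0] := iter_gaut_sub_eq0 (degN m).
  exists n; suff iterE (l' : {scalar {mpoly k[r]}}) :
      iter n (right_diff u) (fun f => l' (gaut_inv f 'X_[m])) =
      (fun f => l' (iter n (fun q => gaut_inv u q - q) (gaut_inv f 'X_[m]))).
    rewrite iterE; apply/funext => f; rewrite (n0 (u^-1)%g) ?linear0 //.
    exact/gaut_inv_graded/homogeneousX.
  elim: (n) l' => // j IHj l'; rewrite iterSr.
  have -> : right_diff u (fun f => l' (gaut_inv f 'X_[m])) =
      (fun f => (l' \o (gaut_inv u \- idfun)) (gaut_inv f 'X_[m])).
    by apply/funext => f; rewrite /right_diff /= -linearB.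
  by rewrite (IHj (l' \o (gaut_inv u \- idfun))).
Qed.

End Unipotent.
End GradedAutomorphisms.

(** * Normal unipotent subgroups in a matrix representation *)

Section NormalUnipotent.
Variables (k : closedFieldType) (G : funGroup k) (n : nat) (L : G -> 'M[k]_n).
Hypothesis LM : forall x y, L (x * y)%g = L x * L y.
Hypothesis L1 : L 1%g = 1.
Hypothesis regL : forall i j, regular (fun x => L x i j).

(** Iterated differences of the entry functions of [L] are the entries of [L x * (L g - 1) ^+ m];
    evaluate at the identity. *)
Lemma unipotent_nilpotent g : unipotent g -> mx_nilpotent (L g - 1).
Proof.
move=> ug.
have iterE m i j : iter m (right_diff g) (fun x => L x i j) =
    (fun x => (L x * (L g - 1) ^+ m) i j).
  elim: m => [|m IH] /=; first by apply/funext => x; rewrite mulr1.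
  rewrite IH; apply/funext => x; rewrite /right_diff LM.
  by rewrite exprS -mulrA mulrBl mul1r mulrBr !mxE.
have /choice[e eE] : forall ij : 'I_n * 'I_n, exists m,
    iter m (right_diff g) (fun x => L x ij.1 ij.2) = (fun=> 0).
  by move=> ij; apply: ug (regL _ _).
exists (\sum_ij e ij)%N; apply/matrixP => i j; rewrite [RHS]mxE.
have := congr1 (@^~ 1%g) (iterE (\sum_ij e ij)%N i j).
rewrite /= L1 mul1r => <-.
by rewrite (bigD1 (i, j)) //= addnC iterD (eE (i, j)) iter_right_diff0.
Qed.

(** If [L x] has a nonzero off-diagonal entry, the product of [x] with its conjugate by a
    transvection [t] is again in [V], against [transvection_conj_not_unipotent]. Otherwise [L x - 1]
    is diagonal and nilpotent. *)
Lemma normal_unipotent_trivial (V : normalSubgroup G) :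
    (forall x, x \in (V : {pred G}) -> unipotent x) ->
    (forall i j, i != j -> (exists x, L x i j != 0) ->
       exists t, L t = 1 + delta_mx j i) ->
  forall x, x \in (V : {pred G}) -> L x = 1.
Proof.
move=> uV transv x xV; have nx := unipotent_nilpotent (uV x xV).
apply/eqP; rewrite -subr_eq0; apply/eqP.
apply: nilpotent_diag_eq0 => // i j ij; apply/eqP; apply: contraT => Aij.
have [t tE] : exists t, L t = 1 + delta_mx j i.
  apply: transv => //; exists x.
  by move: Aij; rewrite !mxE (negPf ij) subr0.
have EE : delta_mx j i * delta_mx j i = 0 :> 'M[k]_n by apply: mul_delta_mx_0.
have tVE : L t^-1%g = 1 - delta_mx j i.
  have : L (t^-1)%g * L t = 1 by rewrite -LM mulVg L1.
  move/(congr1 (fun M => M * (1 - delta_mx j i))).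
  by rewrite -mulrA tE mul1r mulrBr mulr1 mulrDl mul1r EE addr0 addrK mulr1.
case: (transvection_conj_not_unipotent ij Aij nx).
have := unipotent_nilpotent (uV _ (gpredM _ _ xV (ns_normal t xV))).
have -> : 1 + (L x - 1) = L x by rewrite addrC subrK.
by rewrite LM conjgE !LM tVE tE !mulrA.
Qed.

End NormalUnipotent.

(** * Contraction of the kernel by scaling the variables *)

Section UnipotentPaths.
Variables (k : closedFieldType) (r : nat) (N : zmodType) (pi : {additive 'rV[int]_r -> N}).
Local Notation degN := (degN pi).
Local Notation gaut := (gaut k pi).
Hypothesis deg0 : forall m, degN m = 0 -> m = 0%MM.
Implicit Types (u : gaut) (t : k).

Lemma scalar_graded t : graded_mx pi (t%:M : 'M[k]_r).
Proof. by move=> i j; have [->|/negPf ij _] := eqVneq i j; rewrite ?eqxx // mxE ij. Qed.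

Lemma scaling_gaut t : t != 0 -> exists la : gaut,
  (forall m, la 'X_[m] = t ^+ mdeg m *: 'X_[m]) /\
  (forall i, gaut_inv la 'X_i = t^-1 *: 'X_i).
Proof.
move=> t0.
have scX a i : lin_sub (a%:M : 'M[k]_r) 'X_i = a *: 'X_i.
  rewrite lin_subX (bigD1 i) //= mxE eqxx big1 ?addr0 // => j /negPf ji.
  by rewrite mxE ji scale0r.
have tV : t%:M *m (t^-1)%:M = 1%:M :> 'M[k]_r by rewrite -scalar_mxM divff.
have Vt : (t^-1)%:M *m t%:M = 1%:M :> 'M[k]_r by rewrite -scalar_mxM mulVf.
exists (lin_gaut tV Vt (@scalar_graded t) (@scalar_graded t^-1)); split=> [m|i] /=.
  rewrite mpolyXE_id rmorph_prod mdegE -prodrXr.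
  rewrite -[LHS]/(\prod_i lin_sub t%:M ('X_i ^+ m i)).
  under eq_bigr do rewrite rmorphXn /= scX exprZn.
  by rewrite scaler_prod.
exact: scX.
Qed.

(** Conjugating [u] by the scaling of ratio t multiplies the coefficient of a monomial of total
    degree d in [u 'X_i - 'X_i] by t^(d-1). Since d is at least 2, the family is polynomial in t and
    takes the value 1 at t = 0. *)
Lemma unipotent_path u : linpart u = 1%:M -> exists gamma : k -> gaut,
  [/\ gamma 0 = 1%g, gamma 1 = u, forall t, linpart (gamma t) = 1%:M
    & forall F, gaut_regular F -> genAlg [set id]%classic (fun t => F (gamma t))].
Proof.
move=> u1; have [la laE] := choice (fun t : {t : k | t != 0} => scaling_gaut (valP t)).
(* At [t = 0] there is no scaling automorphism; the default value 1 is the limit, and [conjX] holds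
   there as well. *)
pose conj t (v : gaut) := if insub t is Some t' then (la t' * v * (la t')^-1)%g else 1%g.
have conjX t (v : gaut) i : linpart v = 1%:M -> conj t v 'X_i = 'X_i +
    \sum_(m <- msupp (v 'X_i - 'X_i)) ((v 'X_i - 'X_i)@_m * t ^+ (mdeg m).-1) *: 'X_[m].
  move=> v1; have /ordgeP oQ := ordge_morph_sub (gaut_var_ordge1 deg0 v) v1
    (@ordgeX k _ U_(i)%MM); rewrite mdeg1 in oQ.
  set Q := v 'X_i - 'X_i in oQ *; rewrite /conj; case: insubP => [t' t0 <-|]; last first.
    rewrite negbK => /eqP ->; rewrite big_seq big1 ?addr0 // => m /oQ.
    by case: (mdeg m) => [|[|d]] // _; rewrite exprS mul0r mulr0 scale0r.
  have [laX laVX] := laE t'.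
  rewrite -[LHS]/(la t' (v (gaut_inv (la t') 'X_i))) laVX.
  have -> : v ((\val t')^-1 *: 'X_i) = (\val t')^-1 *: ('X_i + Q).
    by rewrite linearZ /Q addrC subrK.
  rewrite linearZ linearD /= laX mdeg1 expr1 scalerDr scalerA mulVf ?scale1r //; last exact: (valP t').
  congr (_ + _); rewrite {1}[Q]mpolyE linear_sum scaler_sumr big_seq [RHS]big_seq.
  apply: eq_bigr => m /oQ m2; rewrite linearZ /= laX !scalerA; congr (_ *: _).
  by rewrite -{1}(prednK (ltnW m2)) exprS [_^-1 * _]mulrC -mulrA mulKf //; apply: (valP t').
have conjV t v : ((conj t v)^-1)%g = conj t (v^-1)%g.
  rewrite /conj; case: insub => [t'|]; last exact: invg1.
  by rewrite !invgM invgK mulgA.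
have linpart_conj t v : linpart (v : gaut) = 1%:M -> linpart (conj t v) = 1%:M.
  move=> v1; rewrite /conj; case: insub => [t'|]; last exact: linpart_id.
  by rewrite !linpart_gautM // v1 mulmx1 linpart_gautVr.
have uV1 : linpart (u^-1)%g = 1%:M :> 'M[k]_r.
  by rewrite -[LHS]mulmx1 -u1 linpart_gautV.
have famX v i : linpart (v : gaut) = 1%:M ->
    polyFamily [set id]%classic (fun t => conj t v 'X_i).
  move=> v1; have /funext -> := fun t => conjX t v i v1.
  apply: FamAdd; first exact: polyFamily_cst.
  apply: polyFamily_sum => m; apply: FamScale; apply: (GenMul (GenCst _ _)).
  elim: (mdeg m).-1 => [|d IH]; first exact: GenCst.
  have -> : (fun t => t ^+ d.+1) = id \* (fun t : k => t ^+ d).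
    by apply/funext => t; rewrite exprS.
  by apply: GenMul => //; apply: GenIn.
exists (fun t => conj t u); split.
- by rewrite /conj insubF ?eqxx.
- apply: gaut_ext; apply: lrmorphism_eq_var => i; rewrite conjX //.
  under eq_bigr do rewrite expr1n mulr1.
  by rewrite -mpolyE addrC subrK.
- by move=> t; apply: linpart_conj.
- apply: gaut_regular_family => i; first exact: famX.
  have -> : (fun t => gaut_inv (conj t u) 'X_i) = (fun t => conj t (u^-1)%g 'X_i).
    by apply/funext => t; rewrite -conjV.
  exact: famX.
Qed.


End UnipotentPaths.

(** * Block matrices and linear substitutions *)

Section Blocks.
Variables (k : fieldType) (r s : nat) (F : 'I_s -> {set 'I_r}) (cls : 'I_r -> 'I_s).
Hypothesis clsF : forall i l, (i \in F l) = (cls i == l).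
Implicit Types (A C : 'M[k]_r) (B D : forall l, 'M[k]_#|F l|).

(** Selecting coordinates by this matrix and its transpose handles diagonal blocks without
    reordering the indices: [E l *m (E l)^T] is 1 and [(E l)^T *m E l] is the projector onto the
    coordinates in [F l]. *)
Definition block_incl l : 'M[k]_(#|F l|, r) := \matrix_(a, j) (enum_val a == j)%:R.
Local Notation E := block_incl.

Definition block A l : 'M[k]_#|F l| := E l *m A *m (E l)^T.
Definition block_sum B : 'M[k]_r := \sum_l (E l)^T *m B l *m E l.

Lemma block_incl_notin l a j : j \notin F l -> E l a j = 0.
Proof.
by move=> jl; rewrite mxE; case: eqP jl => // <-; rewrite enum_valP.
Qed.

Lemma block_incl_tr l : E l *m (E l)^T = 1%:M.
Proof.
apply/matrixP => a b; rewrite !mxE (bigD1 (enum_val a)) //= !mxE eqxx mul1r.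
rewrite big1 ?addr0 => [|j /negPf ja]; last by rewrite !mxE eq_sym ja mul0r.
by rewrite (inj_eq enum_val_inj) eq_sym.
Qed.

Lemma block_incl_tr0 l l' : l != l' -> E l *m (E l')^T = 0.
Proof.
move=> ll'; apply/matrixP => a b; rewrite !mxE big1 // => j _; rewrite [_^T _ _]mxE.
have [jl|/block_incl_notin->] := boolP (j \in F l); last by rewrite mul0r.
rewrite [E l' b j]block_incl_notin ?mulr0 //.
by move: jl; rewrite !clsF => /eqP ->.
Qed.

Lemma block_incl_proj l i j : ((E l)^T *m E l) i j = ((i == j) && (i \in F l))%:R.
Proof.
rewrite mxE; under eq_bigr do rewrite [_^T _ _]mxE.
have [il|il] := boolP (i \in F l); last first.
  by rewrite andbF big1 // => a _; rewrite block_incl_notin ?mul0r.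
rewrite andbT (bigD1 (enum_rank_in il i)) //= !mxE enum_rankK_in // eqxx mul1r.
rewrite big1 ?addr0 // => a ai; rewrite !mxE.
case: eqP => [ae|]; last by rewrite mul0r.
by case/eqP: ai; apply: enum_val_inj; rewrite enum_rankK_in.
Qed.

Lemma block_sum1 : block_sum (fun l => 1%:M) = 1%:M.
Proof.
apply/matrixP => i j; rewrite summxE [RHS]mxE (bigD1 (cls i)) //=.
rewrite mulmx1 block_incl_proj clsF eqxx andbT big1 ?addr0 // => l li.
by rewrite mulmx1 block_incl_proj clsF [cls i == l]eq_sym (negPf li) andbF.
Qed.

Lemma block_sumM B D : block_sum B *m block_sum D = block_sum (fun l => B l *m D l).
Proof.
rewrite mulmx_suml; apply: eq_bigr => l _; rewrite mulmx_sumr (bigD1 l) //=.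
rewrite big1 ?addr0 => [|l' ll']; last first.
  by rewrite !mulmxA -[_ *m E l *m _]mulmxA block_incl_tr0 ?mulmx0 ?mul0mx // eq_sym.
by rewrite !mulmxA -[_ *m E l *m _]mulmxA block_incl_tr mulmx1.
Qed.

Lemma block_sumK B l : block (block_sum B) l = B l.
Proof.
rewrite /block /block_sum mulmx_sumr mulmx_suml (bigD1 l) //= big1 ?addr0 => [|l' ll'].
  by rewrite !mulmxA block_incl_tr mul1mx -mulmxA block_incl_tr mulmx1.
by rewrite !mulmxA block_incl_tr0 ?mul0mx // eq_sym.
Qed.

Lemma block_sum_diff B i j : cls i != cls j -> block_sum B i j = 0.
Proof.
move=> ij; rewrite summxE big1 // => l _; rewrite mxE big1 // => b _.
have [jl|/block_incl_notin->] := boolP (j \in F l); last by rewrite mulr0.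
rewrite mxE big1 ?mul0r // => a _; rewrite [_^T _ _]mxE block_incl_notin ?mul0r //.
by move: jl; rewrite !clsF => /eqP <-.
Qed.

Lemma blockK A : (forall i j, cls i != cls j -> A i j = 0) -> block_sum (block A) = A.
Proof.
move=> Ad; apply/matrixP => i j; rewrite summxE.
have projE l : ((E l)^T *m block A l *m E l) i j =
    ((i \in F l) && (j \in F l))%:R * A i j.
  rewrite /block !mulmxA -(mulmxA _ _ (E l)) mxE (bigD1 j) //= block_incl_proj eqxx /=.
  rewrite big1 ?addr0 => [|b /negPf bj]; last by rewrite block_incl_proj bj mulr0.
  rewrite mxE (bigD1 i) //= block_incl_proj eqxx /= big1 ?addr0 => [|a]; last first.
    by rewrite eq_sym => /negPf ai; rewrite block_incl_proj ai mul0r.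
  by rewrite mulrAC -natrM mulnb.
rewrite (bigD1 (cls i)) //= projE !clsF eqxx /= big1 ?addr0 => [|l li]; last first.
  by rewrite projE clsF [cls i == l]eq_sym (negPf li) mul0r.
by case: eqVneq => [_|]; rewrite ?mul1r // eq_sym => /Ad ->; rewrite mulr0.
Qed.

End Blocks.

Section LinearSection.
Variables (k : fieldType) (r : nat) (N : zmodType) (pi : {additive 'rV[int]_r -> N}).
Variables (s : nat) (F : 'I_s -> {set 'I_r}) (cls : 'I_r -> 'I_s).
Local Notation degN := (degN pi).
Local Notation gaut := (gaut k pi).
Hypothesis deg0 : forall m, degN m = 0 -> m = 0%MM.
Hypothesis clsF : forall i l, (i \in F l) = (cls i == l).
Hypothesis clsP : forall i j, cls i = cls j <-> degN U_(i) = degN U_(j).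

Local Notation GLs := (prodFunGroup (fun l => GL k #|F l|)).
Implicit Types (B : GLs).

(** By [clsP] the classes are the sets of variables of equal degree. *)
Lemma gradedE (A : 'M[k]_r) :
  graded_mx pi A <-> forall i j, cls i != cls j -> A i j = 0.
Proof.
split=> gA i j ij; apply: gA; apply: contra ij => /eqP.
  by move/clsP => ->.
by move/clsP => ->.
Qed.

Definition lin_mx B : 'M[k]_r := block_sum (fun l => \val (B l)).

Lemma lin_mxM B D : lin_mx (B * D)%g = lin_mx B *m lin_mx D.
Proof.
rewrite /lin_mx (block_sumM clsF); congr block_sum.
by apply: functional_extensionality_dep => l; rewrite ffunE.
Qed.

Lemma lin_mx1 : lin_mx 1%g = 1%:M.
Proof.
rewrite -(block_sum1 k clsF) /lin_mx; congr block_sum.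
by apply: functional_extensionality_dep => l; rewrite ffunE.
Qed.

Lemma lin_mxV B : lin_mx B *m lin_mx (B^-1)%g = 1%:M.
Proof. by rewrite -lin_mxM mulgV lin_mx1. Qed.

Lemma lin_mxVl B : lin_mx (B^-1)%g *m lin_mx B = 1%:M.
Proof. by rewrite -lin_mxM mulVg lin_mx1. Qed.

Lemma lin_mx_graded B : graded_mx pi (lin_mx B).
Proof. by apply/gradedE => i j; apply: (block_sum_diff clsF). Qed.

Definition lin_section B : gaut :=
  lin_gaut (lin_mxV B) (lin_mxVl B) (lin_mx_graded B) (lin_mx_graded (B^-1)%g).

Lemma linpart_section B : linpart (lin_section B) = lin_mx B.
Proof. exact: linpart_lin_sub. Qed.

Lemma lin_sectionM B D : lin_section (B * D)%g = (lin_section B * lin_section D)%g.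
Proof.
apply: gaut_ext; apply: lrmorphism_eq_var => i /=.
rewrite !lin_subX linear_sum lin_mxM.
under [RHS]eq_bigr do rewrite linearZ /= lin_subX scaler_sumr.
rewrite exchange_big /=; apply: eq_bigr => j _; rewrite mxE scaler_suml.
by apply: eq_bigr => l _; rewrite scalerA mulrC.
Qed.

Lemma linear_part_blockV (f : gaut) l :
  block F (linpart (f^-1)%g) l *m block F (linpart f) l = 1%:M.
Proof.
have gd g : forall i j, cls i != cls j -> linpart (g : gaut) i j = 0.
  by apply/gradedE; apply: linpart_graded.
have := block_sumM clsF (block F (linpart (f^-1)%g)) (block F (linpart f)).
rewrite !(blockK clsF (gd _)) (linpart_gautV deg0) => /(congr1 (fun M => block F M l)).
rewrite (block_sumK clsF) => <-; rewrite /block mulmx1.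
exact: block_incl_tr.
Qed.

Lemma linear_part_unit (f : gaut) l : block F (linpart f) l \in unitmx.
Proof. exact: (mulmx1_unit (linear_part_blockV f l)).2. Qed.

Definition linear_part (f : gaut) : GLs :=
  [ffun l => exist _ (block F (linpart f) l) (linear_part_unit f l)].

Lemma lin_mx_linear_part f : lin_mx (linear_part f) = linpart f.
Proof.
have <- : block_sum (block F (linpart f)) = linpart f.
  by apply: (blockK clsF); apply/gradedE; apply: linpart_graded.
rewrite /lin_mx; congr block_sum.
by apply: functional_extensionality_dep => l; rewrite ffunE.
Qed.

Lemma lin_mx_inj : injective lin_mx.
Proof.
move=> B D BD; apply/ffunP => l; apply: val_inj.
have := congr1 (fun M => block F M l) BD.
by rewrite /lin_mx !(block_sumK clsF).
Qed.

Lemma regular_lin_mx i j : prod_regular (fun B => lin_mx B i j).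
Proof.
have -> : (fun B => lin_mx B i j) = (fun B => \sum_l \sum_b
    (\sum_a block_incl k F l a i * \val (B l) a b) * block_incl k F l b j).
  apply/funext => B; rewrite summxE; apply: eq_bigr => l _; rewrite mxE.
  by apply: eq_bigr => b _; rewrite mxE; congr (_ * _); apply: eq_bigr => a _; rewrite [_^T _ _]mxE.
apply: genAlg_sum => l _; apply: genAlg_sum => b _; apply: GenMul; last exact: GenCst.
apply: genAlg_sum => a _; apply: (GenMul (GenCst _ _)); apply: GenIn.
exists l, (fun M : GL k #|F l| => \val M a b) => //.
exact: gl_regular_entry.
Qed.

Lemma regular_lin_section (f : gaut -> k) :
  gaut_regular f -> prod_regular (fun B => f (lin_section B)).
Proof.
apply: gaut_regular_family => i.
  have -> : (fun B => lin_section B 'X_i) = (fun B => \sum_j lin_mx B j i *: 'X_j).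
    by apply/funext => B; apply: lin_subX.
  by apply: polyFamily_sum => j; apply: FamScale; apply: regular_lin_mx.
have -> : (fun B => gaut_inv (lin_section B) 'X_i) =
    (fun B => \sum_j lin_mx (B^-1)%g j i *: 'X_j).
  by apply/funext => B; apply: lin_subX.
apply: polyFamily_sum => j; apply: FamScale.
exact: (prod_regular_inv (regular_lin_mx j i)).
Qed.

Lemma regular_linpart i j : gaut_regular (fun f : gaut => linpart f i j).
Proof.
apply: GenIn; exists 'X_j, (mcoeff U_(i)); left.
by apply/funext => f; rewrite mxE.
Qed.

Lemma regular_block l a b : gaut_regular (fun f : gaut => block F (linpart f) l a b).
Proof.
have -> : (fun f : gaut => block F (linpart f) l a b) = (fun f => \sum_j
    (\sum_i block_incl k F l a i * linpart f i j) * block_incl k F l b j).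
  apply/funext => f; rewrite mxE; apply: eq_bigr => j _; rewrite [_^T _ _]mxE.
  by rewrite mxE.
apply: genAlg_sum => j _; apply: GenMul; last exact: GenCst.
apply: genAlg_sum => i _; apply: (GenMul (GenCst _ _)); exact: regular_linpart.
Qed.

(** Entries of blocks are matrix coefficients of the automorphism. The inverse of a block
    determinant is the determinant of the same block for the inverse automorphism, whose
    coefficients are regular too. *)
Lemma regular_linear_part (f : GLs -> k) :
  prod_regular f -> gaut_regular (fun g => f (linear_part g)).
Proof.
apply: genAlg_comp => _ [l [h rh ->]].
move: h rh; apply: genAlg_comp => _ [[a [b ->]]|->].
  have -> : (fun g : gaut => \val (linear_part g l) a b) =
     (fun g => block F (linpart g) l a b) by apply/funext => g; rewrite ffunE.
  exact: regular_block.
have -> : (fun g : gaut => (\det (\val (linear_part g l)))^-1) =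
    (fun g => \det (block F (linpart (g^-1)%g) l)).
  apply/funext => g; rewrite ffunE /=.
  have bV : block F (linpart (g^-1)%g) l *m block F (linpart g) l = 1%:M.
    exact: linear_part_blockV.
  have := congr1 determinant bV; rewrite det_mulmx det1 => dV.
  apply: (mulIf (x := \det (block F (linpart g) l))).
    by rewrite -unitfE; apply: linear_part_unit.
  by rewrite dV mulVf // -unitfE; apply: linear_part_unit.
apply: (gaut_regular_inv (F := fun g => \det (block F (linpart g) l))).
apply: genAlg_sum => sg _; apply: (GenMul (GenCst _ _)).
by apply: genAlg_prod => a _; apply: regular_block.
Qed.

End LinearSection.

(** * The identity component and its unipotent radical *)

Section Weights.
Variables (r : nat) (N : zmodType) (pi : {additive 'rV[int]_r -> N}) (c : 'I_r -> rat).
Hypothesis c1 : forall i, 1 <= c i.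
Hypothesis cE : forall n, pi n = 0 -> \sum_i c i * (n 0 i)%:~R = 0.
Local Notation degN := (degN pi).

Definition weight (m : 'X_{1..r}) : rat := \sum_i c i * (m i)%:R.

Lemma weight_degN m m' : degN m = degN m' -> weight m = weight m'.
Proof.
move=> mm; apply/eqP; rewrite -subr_eq0; apply/eqP.
have := cE (n := \row_i (m i)%:Z - \row_i (m' i)%:Z).
rewrite raddfB -/(degN m) -/(degN m') mm subrr => /(_ erefl) <-.
rewrite -sumrB; apply: eq_bigr => i _; rewrite !mxE -mulrBr; congr (_ * _).
by rewrite intrD mulrNz.
Qed.

Lemma mdeg_weight m : (mdeg m)%:R <= weight m.
Proof.
rewrite mdegE natr_sum; apply: ler_sum => i _.
by rewrite ler_peMl.
Qed.

Lemma weight_deg0 m : degN m = 0 -> m = 0%MM.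
Proof.
rewrite -(degN0 pi) => /weight_degN w0; apply/eqP; rewrite -mdeg_eq0 -leqn0.
rewrite -(ler_nat rat); apply: le_trans (mdeg_weight m) _; rewrite w0.
by rewrite /weight big1 // => i _; rewrite mnm0E mulr0.
Qed.

(** The weight is constant on the monomials of degree [a] and bounds their total degree. *)
Lemma weight_deg_bound a : exists b, forall m, degN m = a -> (mdeg m < b)%N.
Proof.
have [[m0 m0a]|na] := pselect (exists m, degN m = a); last first.
  by exists 0%N => m ma; case: na; exists m.
exists (Num.bound (weight m0)) => m; rewrite -m0a => /weight_degN mw.
rewrite -(ltr_nat rat); apply: le_lt_trans (mdeg_weight m) _; rewrite mw.
by apply: archi_boundP; apply: le_trans (mdeg_weight m0); rewrite ler0n.
Qed.

End Weights.

Section RayClasses.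
Variables (r : nat) (N : zmodType) (pi : {additive 'rV[int]_r -> N}).
Local Notation degN := (degN pi).

(** A semisimple root has entry -1 at [i] and 1 at [j], and its other entries are both nonnegative
    and nonpositive. So it is e_j - e_i, and [pi] kills it exactly when the two degrees agree. *)
Lemma ray_equivE i j : ray_equiv pi i j <-> degN U_(i) = degN U_(j).
Proof.
pose e (i : 'I_r) : 'rV[int]_r := \row_l (U_(i)%MM l : nat)%:Z.
have eE a b l : (e a - e b) 0 l = (a == l)%:Z - (b == l)%:Z.
  by rewrite !mxE !mnm1E.
split=> [[->//|[rho [[rho0 rhoi rho_ge] [_ rhoj rho_le]]]]|ij].
  have ij : i != j.
    by apply: contra_eqN rhoj => /eqP <-; rewrite mxE rhoi.
  have rhoE : rho = e j - e i.
    apply/rowP => l; rewrite eE.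
    have := rho_ge l; have := rho_le l; move: rhoj; rewrite !mxE ![_ == l]eq_sym.
    case: (eqVneq l i) => [->|li]; first by rewrite (negPf ij) rhoi.
    case: (eqVneq l j) => [->|lj] rhoj; first by move=> _ _; apply: oppr_inj; rewrite rhoj.
    by move=> /(_ isT) ? /(_ isT) ?; rewrite subrr; lra.
  apply/esym/eqP; rewrite -subr_eq0 -raddfB.
  by rewrite -[X in pi X]rhoE rho0.
have [->|ne] := eqVneq i j; [by left|right].
exists (e j - e i); split; split.
- by rewrite raddfB -[LHS]/(degN U_(j) - degN U_(i)) ij subrr.
- by rewrite eE eqxx eq_sym (negPf ne).
- by move=> l li; rewrite eE [i == l]eq_sym (negPf li) subr0.
- by rewrite opprB raddfB -[LHS]/(degN U_(i) - degN U_(j)) ij subrr.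
- by rewrite opprB eE eqxx (negPf ne).
- by move=> l lj; rewrite opprB eE [j == l]eq_sym (negPf lj) subr0.
Qed.

Lemma class_function s (F : 'I_s -> {set 'I_r}) : injective F ->
    (forall A, is_equiv_class pi A <-> exists l, F l = A) ->
  exists cls : 'I_r -> 'I_s, (forall i l, (i \in F l) = (cls i == l)) /\
    (forall i j, cls i = cls j <-> degN U_(i) = degN U_(j)).
Proof.
move=> F_inj F_classes; pose A i := [set j | degN U_(i) == degN U_(j)].
have AP i j : A i = A j <-> degN U_(i) = degN U_(j).
  split=> [Aij|ij]; last by apply/setP => l; rewrite !inE ij.
  by have : j \in A i; [rewrite Aij inE|rewrite inE => /eqP].
have /choice[cls clsE] : forall i, exists l, F l = A i.
  move=> i; apply/F_classes; exists i => j; rewrite inE.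
  by split=> [/eqP ij|/ray_equivE ->//]; apply/ray_equivE.
exists cls; split=> [i l|i j]; last first.
  rewrite -AP -!clsE; split=> [->//|]; exact: F_inj.
apply/idP/eqP => [il|<-]; last by rewrite clsE inE.
apply: F_inj; rewrite clsE.
have [i0 i0P] := (F_classes (F l)).2 (ex_intro _ l erefl).
have ii0 := (ray_equivE _ _).1 ((i0P i).1 il).
apply/setP => j; rewrite inE; apply/eqP/idP => [ij|/i0P/ray_equivE <-//].
by apply/i0P/ray_equivE; rewrite ii0.
Qed.

End RayClasses.

Section Connectedness.
Variables (k : closedFieldType) (r : nat) (N : zmodType) (pi : {additive 'rV[int]_r -> N}).
Variables (s : nat) (F : 'I_s -> {set 'I_r}) (cls : 'I_r -> 'I_s).
Local Notation degN := (degN pi).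
Local Notation G := (Autg k pi).
Local Notation gaut := (gaut k pi).
Hypothesis deg0 : forall m, degN m = 0 -> m = 0%MM.
Hypothesis clsF : forall i l, (i \in F l) = (cls i == l).
Hypothesis clsP : forall i j, cls i = cls j <-> degN U_(i) = degN U_(j).
Local Notation GLs := (prodFunGroup (fun l => GL k #|F l|)).

Lemma mem_identity_component (D : {poly k}) (gamma : k -> zariski G) x :
    D.[0] != 0 -> D.[1] != 0 -> gamma 0 = (1%g : G) -> gamma 1 = x ->
    (forall f : G -> k, regular f -> rational_on D (fun t => f (gamma t))) ->
  (x : G) \in identity_component_pred (G := G).
Proof.
move=> D0 D1 g0 g1 rat_gamma; apply/asboolP.
exists (gamma @` [set t | D.[t] != 0])%classic; last by exists 1.
by split=> //; [exists 0|apply: connected_rational_path].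
Qed.

Lemma rational_on_horner_fun (f : k -> k) D : genAlg [set id]%classic f -> rational_on D f.
Proof.
apply: rational_on_genAlg => _ ->; apply: rational_on_ext (rational_on_poly D 'X).
by move=> t _; rewrite hornerX.
Qed.

Lemma unipotent_identity_component (u : gaut) : linpart u = 1%:M ->
  (u : G) \in identity_component_pred (G := G).
Proof.
move=> /(unipotent_path deg0)[gamma [g0 g1 _ reg]].
apply: (@mem_identity_component 1 gamma); rewrite ?hornerC ?oner_neq0 //.
by move=> f /reg /rational_on_horner_fun.
Qed.

(** The segment from 1 to [B], taken in every block, is a rational curve in the group away from the
    zeros of the product [D] of the block determinants. *)
Lemma section_identity_component (B : GLs) :
  (lin_section clsF clsP B : G) \in identity_component_pred (G := G).
Proof.
pose M l (t : k) := (1 - t)%:M + t *: \val (B l).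
(* The default value fills in the parameters where the segment is singular, all of them roots of
   [D]. *)
pose Bt t : GLs := [ffun l => insubd (gl_one k #|F l|) (M l t)].
pose MX l : 'M[{poly k}]_#|F l| := (1 - 'X)%:M + 'X *: map_mx polyC (\val (B l)).
pose D := \prod_l \det (MX l).
have MXE l t : map_mx (horner_eval t) (MX l) = M l t.
  apply/matrixP => i j; rewrite !mxE /horner_eval hornerD hornerM hornerX hornerC.
  by rewrite hornerMn hornerD hornerN hornerX hornerC.
have detE l t : (\det (MX l)).[t] = \det (M l t).
  by rewrite -MXE det_map_mx.
have Dunit t l : D.[t] != 0 -> M l t \in unitmx.
  by rewrite horner_prod prodf_seq_neq0 => /allP/(_ l (mem_index_enum _)); rewrite detE unitmxE unitfE.
have BtE t l : D.[t] != 0 -> \val (Bt t l) = M l t.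
  by move=> Dt; rewrite ffunE insubdK //; apply: Dunit.
have M0 l : M l 0 = 1%:M by rewrite /M subr0 scale0r addr0.
have M1 l : M l 1 = \val (B l) by rewrite /M subrr scale1r raddf0 add0r.
have D0 : D.[0] != 0.
  by rewrite horner_prod; apply/prodf_neq0 => l _; rewrite detE M0 det1 oner_neq0.
have D1 : D.[1] != 0.
  rewrite horner_prod; apply/prodf_neq0 => l _; rewrite detE M1.
  by rewrite -unitfE -unitmxE; apply: valP.
apply: (@mem_identity_component D (fun t => lin_section clsF clsP (Bt t))) => //.
- have -> : Bt 0 = 1%g.
    by apply/ffunP => l; apply: val_inj; rewrite BtE // M0 ffunE.
  by apply: (mulgI (lin_section clsF clsP 1%g)); rewrite mulg1 -lin_sectionM mulg1.
- congr (lin_section _ _ _).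
  by apply/ffunP => l; apply: val_inj; rewrite BtE // M1.
move=> f /(regular_lin_section clsF clsP) rf.
apply: (@rational_on_genAlg _ (rational_on D)) => //.
move: rf; apply: genAlg_comp => _ [l [h rh ->]].
move: h rh; apply: genAlg_comp => _ [[a [b ->]]|->]; apply: GenIn.
  apply: rational_on_ext (rational_on_poly D (MX l a b)) => t Dt.
  by rewrite BtE // -MXE [in RHS]mxE.
exists 1, (\det (MX l)) => t Dt; rewrite detE BtE // hornerC div1r; split=> //.
by rewrite -unitfE -unitmxE; apply: Dunit.
Qed.

(** Write [x] as the linear substitution [y] with the same linear part times an element of the
    kernel of [linpart]. *)
Lemma identity_component_all (x : gaut) : (x : G) \in identity_component_pred (G := G).
Proof.
set y := lin_section clsF clsP (linear_part deg0 clsF clsP x).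
have yE : linpart y = linpart x by rewrite linpart_section lin_mx_linear_part.
have -> : x = (y * (y^-1 * x))%g by rewrite mulgA mulgV mul1g.
apply: (gpredM (s := identity_component_pred (G := G))).
  exact: section_identity_component.
by apply: unipotent_identity_component; rewrite linpart_gautM // -yE linpart_gautV.
Qed.

End Connectedness.

Section LinpartKernel.
Variables (k : fieldType) (r : nat) (N : zmodType) (pi : {additive 'rV[int]_r -> N}).
Local Notation degN := (degN pi).
Local Notation G0 := (identity_component (Autg k pi)).

Definition comp_linpart (x : G0) : 'M[k]_r := linpart (\val x : gaut k pi).

Lemma comp_linpartM : (forall m, degN m = 0 -> m = 0%MM) ->
  forall x y : G0, comp_linpart (x * y)%g = comp_linpart x * comp_linpart y.
Proof. by move=> deg0 x y; apply: linpart_gautM. Qed.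

Lemma comp_linpart1 : comp_linpart 1%g = 1.
Proof. exact: linpart_id. Qed.

Lemma regular_comp_linpart i j : regular (fun x : G0 => comp_linpart x i j).
Proof.
by exists (fun f : Autg k pi => linpart (f : gaut k pi) i j) => //; apply: regular_linpart.
Qed.

(* The proof of [deg0] is an argument so that the instances below can be declared. *)
Definition linpart_kernel (deg0 : forall m, degN m = 0 -> m = 0%MM) : {pred G0} :=
  fun x => comp_linpart x == 1.

Variable deg0 : forall m, degN m = 0 -> m = 0%MM.

Lemma linpart_kernel_div (x y : G0) :
  ((x^-1 * y)%g \in linpart_kernel deg0) = (comp_linpart x == comp_linpart y).
Proof.
have Vx : comp_linpart (x^-1)%g * comp_linpart x = 1.
  by rewrite -comp_linpartM // mulVg comp_linpart1.
have xV : comp_linpart x * comp_linpart (x^-1)%g = 1.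
  by rewrite -comp_linpartM // mulgV comp_linpart1.
rewrite unfold_in /linpart_kernel comp_linpartM //; apply/eqP/eqP => [E|<-//].
by rewrite -[LHS]mulr1 -E mulrA xV mul1r.
Qed.

Lemma linpart_kernel_group_closed : group_closed (linpart_kernel deg0).
Proof.
split=> [|x y]; first by rewrite unfold_in /linpart_kernel comp_linpart1.
rewrite ![_ \in linpart_kernel _]unfold_in /linpart_kernel => /eqP x1 /eqP y1.
have yV1 : comp_linpart (y^-1)%g = 1.
  by rewrite -[LHS]mulr1 -y1 -comp_linpartM // mulVg comp_linpart1.
by rewrite comp_linpartM // x1 yV1 mulr1.
Qed.

HB.instance Definition _ := isMulClosed.Build G0 (linpart_kernel deg0)
  (group_closedM linpart_kernel_group_closed).
HB.instance Definition _ := isMul1Closed.Build G0 (linpart_kernel deg0)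
  linpart_kernel_group_closed.1.
HB.instance Definition _ := isInvClosed.Build G0 (linpart_kernel deg0)
  (group_closedV linpart_kernel_group_closed).

Lemma linpart_kernel_normal (x y : G0) :
  x \in linpart_kernel deg0 -> (x ^ y)%g \in linpart_kernel deg0.
Proof.
rewrite ![_ \in linpart_kernel _]unfold_in /linpart_kernel => /eqP x1.
by rewrite conjgE !comp_linpartM // x1 mul1r -comp_linpartM // mulVg comp_linpart1.
Qed.

Definition linpart_radical : normalSubgroup G0 := NormalSubgroup linpart_kernel_normal.

End LinpartKernel.

Section Radical.
Variables (k : closedFieldType) (r : nat) (N : zmodType) (pi : {additive 'rV[int]_r -> N}).
Local Notation degN := (degN pi).
Local Notation G := (Autg k pi).
Local Notation G0 := (identity_component G).
Local Notation gaut := (gaut k pi).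
Hypothesis deg0 : forall m, degN m = 0 -> m = 0%MM.
Hypothesis deg_bound : forall a, exists b, forall m, degN m = a -> (mdeg m < b)%N.
Hypothesis G_connected : forall x : gaut, (x : G) \in identity_component_pred (G := G).

Definition to_component (x : gaut) : G0 := exist _ (x : G) (G_connected x).

Lemma linpart_radical_closed :
  closed ((fun x => x \in linpart_kernel deg0) : set (zariski G0)).
Proof.
rewrite -[X in closed X]setCK; apply: open_closedC; rewrite zariski_openE.
exists (fun f => exists i j, f = fun x : G0 => comp_linpart x i j - (1%:M : 'M[k]_r) i j).
  move=> _ [i [j ->]]; apply: (regularD (h := fun=> - (1%:M : 'M[k]_r) i j)).
    exact: regular_comp_linpart.
  exact: regular_cst.
move=> x; split=> [/negP|[_ [i [j ->]] ne] /eqP x1]; last first.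
  by move: ne; rewrite x1 subrr eqxx.
rewrite unfold_in /linpart_kernel => x1; apply: contrapT => all0.
case/eqP: x1; apply/matrixP => i j; apply/eqP; rewrite -subr_eq0; apply: contraT => ne.
by case: all0; exists (fun x : G0 => comp_linpart x i j - (1%:M : 'M[k]_r) i j) => //; exists i, j.
Qed.

Lemma linpart_radical_connected :
  connected ((fun x => x \in linpart_kernel deg0) : set (zariski G0)).
Proof.
pose U : set (zariski G0) := fun x => x \in linpart_kernel deg0.
(* The kernel is the union of its connected subsets through 1, because [unipotent_path] joins each
   of its points to 1 inside it. *)
pose C : set (set (zariski G0)) := fun A => [/\ A (1%g : G0), (A `<=` U)%classic & connected A].
rewrite [X in connected X](_ : _ = (\bigcup_(A in C) A)%classic).
  by apply: bigcup_connected => [|A [] //]; exists (1%g : G0) => A [].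
apply/seteqP; split=> [x /eqP x1|x [A [_ AU _] Ax]]; last exact: AU.
have [gamma [g0 g1 gU reg]] := unipotent_path deg0 x1.
pose delta t : zariski G0 := to_component (gamma t).
exists (delta @` [set t | (1 : {poly k}).[t] != 0])%classic; last first.
  by exists 1; rewrite /= ?hornerC ?oner_neq0 //; apply: val_inj.
split.
- by exists 0; rewrite /= ?hornerC ?oner_neq0 //; apply: val_inj.
- by move=> _ [t _ <-]; apply/eqP; apply: gU.
- apply: connected_rational_path => f [h rh ->].
  exact: rational_on_horner_fun (reg _ rh).
Qed.

Lemma linpart_radical_unipotent (x : G0) : x \in linpart_kernel deg0 -> unipotent x.
Proof.
move=> /eqP x1 f [h rh ->].
have [n n0] := linpart1_locnil deg0 deg_bound (u := \val x) x1 rh.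
exists n; suff iterE : iter n (right_diff x) (fun y : G0 => h (\val y)) =
    (fun y : G0 => iter n (right_diff (\val x : G)) h (\val y)).
  by rewrite [LHS]iterE n0.
by elim: (n) => // m IH; rewrite !iterS IH.
Qed.

Lemma linpart_is_unipotent_radical : is_unipotent_radical (linpart_radical k deg0).
Proof.
split=> [|V [_ _ uV] x xV].
  split; [exact: linpart_radical_closed|exact: linpart_radical_connected|].
  exact: linpart_radical_unipotent.
apply/eqP; apply: (normal_unipotent_trivial (@comp_linpartM k _ _ _ deg0) (@comp_linpart1 _ _ _ _)
  (@regular_comp_linpart k _ _ pi) uV) => // i j ij [y yij].
(* A nonzero entry at [(i, j)] forces equal degrees, so the transvection at the transposed position
   is a graded substitution. *)
have dij : degN U_(i) = degN U_(j).
  by apply/eqP; apply: contraNT yij => /linpart_graded-> //; rewrite eqxx.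
have EE : delta_mx j i *m delta_mx j i = 0 :> 'M[k]_r by rewrite mul_delta_mx_0 // eq_sym.
have grad (a : k) : graded_mx pi (1%:M + a *: delta_mx j i).
  move=> a' b' ab; rewrite !mxE; case: (eqVneq a' b') ab => [->|_ ab]; first by rewrite eqxx.
  rewrite add0r; case: (eqVneq a' j) ab => [->|]; last by rewrite mulr0.
  by case: (eqVneq b' i) => [->|]; [rewrite dij eqxx|rewrite mulr0].
have inv (a b : k) : a + b = 0 ->
    (1%:M + a *: delta_mx j i) *m (1%:M + b *: delta_mx j i) = 1%:M.
  move=> ab; rewrite mulmxDr mulmx1 mulmxDl mul1mx -scalemxAl -scalemxAr EE !scaler0 addr0.
  by rewrite -addrA -scalerDl ab scale0r addr0.
exists (to_component (lin_gaut (inv 1 (-1) (subrr _)) (inv (-1) 1 (addNr _)) (@grad 1) (@grad (-1)))).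
by rewrite /comp_linpart /= linpart_lin_sub scale1r.
Qed.

Variables (s : nat) (F : 'I_s -> {set 'I_r}) (cls : 'I_r -> 'I_s).
Hypothesis clsF : forall i l, (i \in F l) = (cls i == l).
Hypothesis clsP : forall i j, cls i = cls j <-> degN U_(i) = degN U_(j).
Local Notation GLs := (prodFunGroup (fun l => GL k #|F l|)).

Lemma quot_radicalP (x y : G0) :
  quot_pi (linpart_radical k deg0) x = quot_pi (linpart_radical k deg0) y <->
  comp_linpart x = comp_linpart y.
Proof.
rewrite quot_piP /coset_rel [_ \in _](linpart_kernel_div deg0 x y).
by split=> /eqP.
Qed.

(** Cosets of the kernel are the fibres of [linpart], so the section followed by the projection is
    inverted by reading the linear part of any representative. *)
Theorem radical_quotient_iso : fg_iso GLs (quotFunGroup (linpart_radical k deg0)).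
Proof.
pose phi (B : GLs) : quotFunGroup (linpart_radical k deg0) :=
  quot_pi (linpart_radical k deg0) (to_component (lin_section clsF clsP B)).
have phiE (x : G0) : phi (linear_part deg0 clsF clsP (\val x)) = quot_pi (linpart_radical k deg0) x.
  apply/quot_radicalP; rewrite [LHS]linpart_section.
  exact: lin_mx_linear_part.
exists phi; split.
- exists (fun X => linear_part deg0 clsF clsP (\val (repr X : G0))) => [B|X]; last first.
    by rewrite phiE quot_repr.
  apply: (lin_mx_inj clsF); rewrite lin_mx_linear_part -(linpart_section clsF clsP).
  exact: (quot_radicalP _ _).1 (quot_repr (phi B)).
- move=> B D; rewrite -quot_piM; congr quot_pi; apply: val_inj.
  exact: lin_sectionM.
move=> f; split=> [[h rh fh]|rf].
  have -> : (fun B => f (phi B)) = (fun B => h (lin_section clsF clsP B)).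
    by apply/funext => B; rewrite [LHS](congr1 (@^~ (to_component _)) fh).
  exact: regular_lin_section.
(* Regularity on the quotient asks for a regular function on the whole group that restricts to the
   pullback of [f]. *)
exists (fun g : G => f (phi (linear_part deg0 clsF clsP g))).
  exact: (regular_linear_part deg0 clsF clsP rf).
by apply/funext => x; rewrite phiE.
Qed.

End Radical.

Theorem theorem6p6
    (k : closedFieldType) (char0 : [pchar k] =i pred0)
    (d : nat) (Delta : set (set 'cV[rat]_d))
    (fan_Delta : is_fan Delta) (complete_Delta : is_complete Delta)
    (r : nat) (v : 'I_r -> 'cV[int]_d) (v_inj : injective v)
    (v_rays : forall w, is_ray Delta w <-> exists i, v i = w)
    (N : zmodType) (pi : {additive 'rV[int]_r -> N})
    (N_class : is_class_group v pi)
    (s : nat) (F : 'I_s -> {set 'I_r}) (F_inj : injective F)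
    (F_classes : forall A, is_equiv_class pi A <-> exists l, F l = A) :
  exists Ru : normalSubgroup (identity_component (Autg k pi)),
    is_unipotent_radical Ru /\
    fg_iso (prodFunGroup (fun l => GL k #|F l|)) (quotFunGroup Ru).
Proof.
have [c c1 cE] := class_group_weight fan_Delta complete_Delta v_rays N_class.
have deg0 := weight_deg0 c1 cE; have deg_bound := weight_deg_bound c1 cE.
have [cls [clsF clsP]] := class_function F_inj F_classes.
have conn := identity_component_all deg0 clsF clsP.
exists (linpart_radical k deg0); split; last exact: radical_quotient_iso.
exact: linpart_is_unipotent_radical.
Qed.
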